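(* Let $\mathbf k$ be a field of characteristic zero, and let $P$ be a modular operad in complexes of $\mathbf k$-vector spaces with homology of finite type. The following statements are equivalent: (1) $P$ is formal. (2) There exists a model $P'$ of $P$ such that $H:\mathrm{Aut}(P')\to\mathrm{Aut}(HP)$ is surjective. (3) There exist a model $P'$ of $P$ and $f\in\mathrm{Aut}(P')$ such that $Hf=\phi_\alpha$ for some $\alpha\in\mathbf k^*$ that is not a root of unity. (4) There exists a pure endomorphism $f$ (with respect to some weight function on $\mathbf k$) of a model $P'$ of $P$.
   Context: Modular operads (Getzler–Kapranov) in complexes of $\mathbf k$-vector spaces (differential of degree $-1$, Koszul signs): families $P((g,l))$, $g,l\ge0$, $2g-2+l>0$, of complexes with right $\Sigma_l$-actions, compositions $\circ_i:P((g,l))\otimes P((h,m))\to P((g+h,l+m-2))$, $1\le i\le l$, and contractions $\xi_{ij}:P((g,l))\to P((g+1,l-2))$, $i\neq j$, satisfying the usual axioms of associativity, commutativity, equivariance and compatibility (no units). $HP$ is the modular operad of componentwise homology with zero differential. A weak equivalence is a morphism that is a homology isomorphism for every $(g,l)$. Two modular operads joined by a finite zigzag of weak equivalences are called weakly equivalent, and each is a model of the other. $P$ is formal if it is weakly equivalent to $HP$. $P$ has homology of finite type if each $HP((g,l))$ is a finite dimensional $\mathbf k$-vector space. $\mathrm{Aut}$ denotes the group of automorphisms of modular operads; for a model $P'$ of $P$, $HP'$ is identified with $HP$ via the zigzag. Grading automorphism. For $\alpha\in\mathbf k^*$, $\phi_\alpha$ is the automorphism of $HP$ that is multiplication by $\alpha^i$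 on homological degree $i$. Purity. A weight function on $\mathbf k$ is a group morphism $w:\Gamma\to\mathbb Z$ on a subgroup $\Gamma\subset\overline{\mathbf k}^*$. An endomorphism of a finite dimensional $\mathbf k$-vector space is pure of weight $n$ if all roots $\lambda\in\overline{\mathbf k}$ of its characteristic polynomial lie in $\Gamma$ and satisfy $w(\lambda)=n$. An endomorphism $f$ of a modular operad $P'$ is called pure if for all $(g,l)$ and all degrees $i$ the induced endomorphism of $H_iP'((g,l))$ is pure of weight $i$ (i.e. $f$ is pure of weight $0$). *)

(* Defs.v *)
From HB Require Import structures.
From mathcomp Require Import all_boot all_order all_algebra all_fingroup.
From mathcomp Require Import generic_quotient ring_quotient boolp.

Set Implicit Arguments.
Unset Strict Implicit.
Unset Printing Implicit Defensive.

Import GRing.Theory.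
Local Open Scope ring_scope.
Local Open Scope quotient_scope.

Definition mk_linear (k : fieldType) (U V : lmodType k) (f : U -> V)
    (lf : linear f) : {linear U -> V} :=
  HB.pack f (GRing.isLinear.Build k U V *:%R f lf).

(* ring_quotient only provides the additive group structure on V / S. *)
Section ModuleQuotient.
Variables (k : fieldType) (V : lmodType k) (S : submodClosed V).

Definition submod_pred : {pred V} := S.

Lemma submod_pred_closed : submod_closed submod_pred.
Proof.
by rewrite /submod_pred; split=> [|a x y xS yS]; rewrite ?rpred0 ?rpredD ?rpredZ.
Qed.
HB.instance Definition _ :=
  GRing.isSubmodClosed.Build k V submod_pred submod_pred_closed.

Definition lmod_quot : Type := Quotient.quot submod_pred.
HB.instance Definition _ := GRing.Zmodule.on lmod_quot.

Definition lmod_proj (x : V) : lmod_quot := \pi_(Quotient.quot submod_pred) x.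

Lemma lmod_projK (q : lmod_quot) :
  lmod_proj (repr (q : Quotient.quot submod_pred)) = q.
Proof. exact: reprK. Qed.

Lemma lmod_proj_eq x y : (lmod_proj x = lmod_proj y) <-> (x - y \in S).
Proof. by rewrite (Quotient.idealrBE submod_pred); split=> /eqP. Qed.

Lemma lmod_projD x y : lmod_proj (x + y) = lmod_proj x + lmod_proj y.
Proof. exact: (raddfD (\pi_(Quotient.quot submod_pred))). Qed.

Definition lmod_quot_scale (a : k) (q : lmod_quot) : lmod_quot :=
  lmod_proj (a *: repr (q : Quotient.quot submod_pred)).

Lemma lmod_projZ a x : lmod_proj (a *: x) = lmod_quot_scale a (lmod_proj x).
Proof.
apply/lmod_proj_eq; rewrite -scalerBr rpredZ //.
by apply/lmod_proj_eq; rewrite lmod_projK.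
Qed.

Lemma lmod_quot_scaleA a b q :
  lmod_quot_scale a (lmod_quot_scale b q) = lmod_quot_scale (a * b) q.
Proof. by rewrite -(lmod_projK q) -!lmod_projZ scalerA. Qed.

Lemma lmod_quot_scale1 : left_id 1 lmod_quot_scale.
Proof. by move=> q; rewrite -(lmod_projK q) -!lmod_projZ scale1r. Qed.

Lemma lmod_quot_scaleDr : right_distributive lmod_quot_scale +%R.
Proof.
move=> a q r; rewrite -(lmod_projK q) -(lmod_projK r) -lmod_projD -!lmod_projZ.
by rewrite scalerDr lmod_projD.
Qed.

Lemma lmod_quot_scaleDl q :
  {morph lmod_quot_scale^~ q : a b / a + b}.
Proof. by move=> a b; rewrite -(lmod_projK q) -!lmod_projZ scalerDl lmod_projD. Qed.

HB.instance Definition _ := GRing.Zmodule_isLmodule.Build k lmod_quot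
  lmod_quot_scaleA lmod_quot_scale1 lmod_quot_scaleDr lmod_quot_scaleDl.

Lemma lmod_proj_linear : linear lmod_proj.
Proof. by move=> a x y; rewrite lmod_projD lmod_projZ. Qed.
HB.instance Definition _ :=
  GRing.isLinear.Build k V lmod_quot *:%R lmod_proj lmod_proj_linear.

End ModuleQuotient.

Definition finite_dim (k : fieldType) (V : lmodType k) : Prop :=
  exists (n : nat) (e : {linear 'rV[k]_n -> V}), bijective e.

(* e is a basis of V, and M is the matrix of f in that basis (acting on row
   vectors of coordinates). *)
Definition is_char_poly (k : fieldType) (V : lmodType k)
    (f : {linear V -> V}) (p : {poly k}) : Prop :=
  exists (n : nat) (e : {linear 'rV[k]_n -> V}) (M : 'M[k]_n),
    [/\ bijective e, forall v, f (e v) = e (v *m M) & p = char_poly M].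

(* Structure maps (here the differential, below the compositions) are given
   for all target indices and vanish unless the indices match.  This makes
   composites such as those in the associativity axioms well typed without
   transport along equalities of indices.  Complexes are graded by all
   integers. *)
Record complex (k : fieldType) := Complex {
  component :> int -> lmodType k;
  diff : forall i j, {linear component i -> component j};
  diff_dead : forall i j x, i != j + 1 -> diff i j x = 0;
  diffK : forall i j l x, diff j l (diff i j x) = 0
}.
Arguments diff {k c} i j.

Section Homology.
Variables (k : fieldType) (C : complex k) (i : int).

Definition is_cycle : {pred C i} := fun x => diff i (i - 1) x == 0.

Lemma is_cycle_submod : submod_closed is_cycle.
Proof.
split=> [|a x y]; rewrite !unfold_in /is_cycle ?linear0 //.
by move=> /eqP dx /eqP dy; rewrite linearP dx dy scaler0 addr0.
Qed.
HB.instance Definition _ :=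
  GRing.isSubmodClosed.Build k (C i) is_cycle is_cycle_submod.

Record cycle := Cycle { cycle_val : C i; cycleP : cycle_val \in is_cycle }.
HB.instance Definition _ := [isSub for cycle_val].
HB.instance Definition _ := [Choice of cycle by <:].
HB.instance Definition _ := [SubChoice_isSubLmodule of cycle by <:].

Definition is_boundary : {pred cycle} :=
  fun z => `[< exists y, diff (i + 1) i y = val z >].

Lemma is_boundary_submod : submod_closed is_boundary.
Proof.
split=> [|a x y]; rewrite !unfold_in.
  by apply/asboolP; exists 0; rewrite !linear0.
move=> /asboolP [x' dx] /asboolP [y' dy]; apply/asboolP.
by exists (a *: x' + y'); rewrite !linearP /= dx dy.
Qed.
HB.instance Definition _ :=
  GRing.isSubmodClosed.Build k cycle is_boundary is_boundary_submod.

Definition homology : lmodType k := lmod_quot is_boundary.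

(* The class of a cycle, extended by 0 to all elements. *)
Definition cls (x : C i) : homology :=
  if insub x is Some z then lmod_proj is_boundary z else 0.

Definition rep (h : homology) : C i := val (repr (h : Quotient.quot (submod_pred is_boundary))).

Lemma rep_cycle h : rep h \in is_cycle.
Proof. exact: cycleP. Qed.

Lemma repK h : cls (rep h) = h.
Proof. by rewrite /cls valK lmod_projK. Qed.

Lemma cls_eq x y : x \in is_cycle -> y \in is_cycle ->
  (cls x = cls y) <-> (exists z, diff (i + 1) i z = x - y).
Proof.
move=> cx cy; rewrite /cls !insubT /= lmod_proj_eq.
by split=> [/asboolP|h]; last exact/asboolP.
Qed.

Lemma clsP h : exists2 x, x \in is_cycle & h = cls x.
Proof. by exists (rep h); rewrite ?rep_cycle ?repK. Qed.

Lemma cls_linear a x y : x \in is_cycle -> y \in is_cycle ->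
  cls (a *: x + y) = a *: cls x + cls y.
Proof.
move=> cx cy; have cz : a *: x + y \in is_cycle by rewrite rpredD ?rpredZ.
rewrite /cls !insubT -linearP; congr lmod_proj; exact: val_inj.
Qed.

Lemma cls0 : cls 0 = 0.
Proof.
rewrite /cls; case: insubP => //= z _ z0.
by rewrite (_ : z = 0) ?linear0 //; apply: val_inj; rewrite linear0.
Qed.

Lemma clsZ a x : x \in is_cycle -> cls (a *: x) = a *: cls x.
Proof.
by move=> cx; rewrite -[a *: x]addr0 cls_linear ?rpred0 // cls0 addr0.
Qed.

Lemma is_cycleP x : reflect (forall j, diff i j x = 0) (x \in is_cycle).
Proof.
apply: (iffP eqP) => [dx j|->//]; have [e|ne] := eqVneq i (j + 1).
  by rewrite -[j](addrK 1) -e.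
exact: diff_dead.
Qed.

Lemma rep_cls x : x \in is_cycle ->
  exists z, diff (i + 1) i z = rep (cls x) - x.
Proof. by move=> cx; apply/cls_eq; rewrite ?repK ?rep_cycle. Qed.

End Homology.

Section HomologyMap.
Variables (k : fieldType) (C D : complex k) (i j : int).
Variable f : {linear C i -> D j}.
Hypothesis f_cycle : forall x, x \in @is_cycle k C i -> f x \in @is_cycle k D j.
Hypothesis f_boundary : forall y, exists z,
  diff (j + 1) j z = f (diff (i + 1) i y).

Lemma homology_mapE x : x \in @is_cycle k C i ->
  cls (f (rep (cls x))) = cls (f x).
Proof.
move=> cx; apply/cls_eq; rewrite ?f_cycle ?rep_cycle //.
have [y dy] := rep_cls cx; have [z dz] := f_boundary y.
by exists z; rewrite dz dy linearB.
Qed.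

Lemma homology_map_linear :
  linear (fun h : homology C i => cls (f (rep h))).
Proof.
move=> a x y; rewrite -cls_linear ?f_cycle ?rep_cycle // -linearP.
rewrite -[in LHS](repK x) -[in LHS](repK y) -cls_linear ?rep_cycle //.
by rewrite homology_mapE // rpredD ?rpredZ ?rep_cycle.
Qed.

Definition homology_map : {linear homology C i -> homology D j} :=
  mk_linear homology_map_linear.

End HomologyMap.

Section HomologyComplex.
Variables (k : fieldType) (C : complex k).

Definition zero_diff (i j : int) : {linear homology C i -> homology C j} := \0.

Lemma zero_diff_dead i j x : i != j + 1 -> zero_diff i j x = 0.
Proof. by []. Qed.

Lemma zero_diffK i j l x : zero_diff j l (zero_diff i j x) = 0.
Proof. by []. Qed.

Definition homology_complex : complex k :=
  Complex zero_diff_dead zero_diffK.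

End HomologyComplex.

Section LegNumbering.
Local Open Scope nat_scope.

Definition stable (g l : nat) : bool := 2 < g.*2 + l.

(* Legs are numbered from 0.  The composition a o_i b glues leg i of a to leg 0
   of b; the l2 other legs of b take the place of leg i.  Thus, in a o_i b, the
   leg x != i of a becomes leg_l l2 i x and the leg y != 0 of b becomes
   leg_r i y. *)
Definition leg_l (l2 i x : nat) : nat := if x < i then x else x.-1 + l2.
Definition leg_r (i y : nat) : nat := i + y.-1.

(* Number of the leg x != i, j after contraction of the legs i and j. *)
Definition leg_c (i j x : nat) : nat := x - (i < x) - (j < x).

End LegNumbering.

(* (g, l, p) is the genus, number of legs and degree of a composition of
   elements of arities l1 + 1 and l2 + 1. *)
Definition glues (g1 l1 : nat) (p1 : int) (g2 l2 : nat) (p2 : int)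
    (g l : nat) (p : int) : bool :=
  [&& g == (g1 + g2)%N, l == (l1 + l2)%N & p == p1 + p2].

(* Conventions.
   - car g l is P((g,l)) for 2g - 2 + l > 0 and is 0 otherwise.
   - contr i j is defined for i != j only, hence contr i i = 0.
   - The leg x of a becomes the leg s x of act s a; since (s * t) x = t (s x)
     in MathComp, this is a right action of 'S_l.
   - Equivariance is stated with the permutation r of the remaining legs
     characterized by its values; such an r exists and is unique.
   - Composition of a at leg i with b at an arbitrary leg j is comp j b (act s a)
     with s i = 0, by comp_comm; the compatibilities in which the roles of the
     two factors are exchanged follow in the same way. *)
Record modop (k : fieldType) := Modop {
  car :> nat -> nat -> complex k;
  car_unstable : forall g l p (a : car g l p), ~~ stable g l -> a = 0;

  act : forall g l p, 'S_l -> {linear car g l p -> car g l p};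
  comp : forall g1 l1 p1 g2 l2 p2 g l p,
    'I_l1.+1 -> car g1 l1.+1 p1 -> car g2 l2.+1 p2 -> car g l p;
  contr : forall g l p,
    'I_l.+2 -> 'I_l.+2 -> {linear car g l.+2 p -> car g.+1 l p};

  act1 : forall g l p (a : car g l p), act g p 1%g a = a;
  actM : forall g l p (s t : 'S_l) (a : car g l p),
    act g p (s * t)%g a = act g p t (act g p s a);
  act_diff : forall g l p q (s : 'S_l) (a : car g l p),
    diff p q (act g p s a) = act g q s (diff p q a);

  comp_dead : forall g1 l1 p1 g2 l2 p2 g l p i
      (a : car g1 l1.+1 p1) (b : car g2 l2.+1 p2),
    ~~ glues g1 l1 p1 g2 l2 p2 g l p -> comp g l p i a b = 0;
  comp_linear_l : forall g1 l1 p1 g2 l2 p2 g l p i (b : car g2 l2.+1 p2),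
    linear (fun a : car g1 l1.+1 p1 => comp g l p i a b);
  comp_linear_r : forall g1 l1 p1 g2 l2 p2 g l p i (a : car g1 l1.+1 p1),
    linear (fun b : car g2 l2.+1 p2 => comp g l p i a b);
  comp_diff : forall g1 l1 (p1 q1 : int) g2 l2 (p2 q2 : int) g l (p q : int) i
      (a : car g1 l1.+1 p1) (b : car g2 l2.+1 p2),
    glues g1 l1 p1 g2 l2 p2 g l p ->
    p1 = q1 + 1 -> p2 = q2 + 1 -> p = q + 1 ->
    diff p q (comp g l p i a b) =
      comp g l q i (diff p1 q1 a) b
      + (-1) ^ p1 *: comp g l q i a (diff p2 q2 b);

  contr_dead : forall g l p i (a : car g l.+2 p), contr g p i i a = 0;
  contr_diff : forall g l p q i j (a : car g l.+2 p),
    diff p q (contr g p i j a) = contr g q i j (diff p q a);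

  comp_act : forall g1 l1 p1 g2 l2 p2 g l p (i : 'I_l1.+1)
      (s : 'S_l1.+1) (t : 'S_l2.+1) (r : 'S_l)
      (a : car g1 l1.+1 p1) (b : car g2 l2.+1 p2),
    glues g1 l1 p1 g2 l2 p2 g l p -> t ord0 = ord0 ->
    (forall (x : 'I_l1.+1) (z : 'I_l), x != i -> z = leg_l l2 i x :> nat ->
       r z = leg_l l2 (s i) (s x) :> nat) ->
    (forall (y : 'I_l2.+1) (z : 'I_l), y != ord0 -> z = leg_r i y :> nat ->
       r z = leg_r (s i) (t y) :> nat) ->
    comp g l p (s i) (act g1 p1 s a) (act g2 p2 t b) =
      act g p r (comp g l p i a b);
  comp_comm : forall g1 l1 p1 g2 l2 p2 g l p (i : 'I_l1.+1)
      (s : 'S_l1.+1) (r : 'S_l)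
      (a : car g1 l1.+1 p1) (b : car g2 l2.+1 p2),
    glues g1 l1 p1 g2 l2 p2 g l p -> s i = ord0 ->
    (forall (x : 'I_l1.+1) (z : 'I_l), x != i -> z = leg_l l2 i x :> nat ->
       r z = leg_r 0 (s x) :> nat) ->
    (forall (y : 'I_l2.+1) (z : 'I_l), y != ord0 -> z = leg_r i y :> nat ->
       r z = leg_l l1 0 y :> nat) ->
    act g p r (comp g l p i a b) =
      (-1) ^ (p1 * p2) *: comp g l p ord0 b (act g1 p1 s a);
  comp_assoc : forall g1 l1 p1 g2 l2 p2 g3 l3 p3 g12 l12 p12 g23 l23 p23 g l p
      (i : 'I_l1.+1) (j : 'I_l2.+1) (m : 'I_l12.+1)
      (a : car g1 l1.+1 p1) (b : car g2 l2.+1 p2) (c : car g3 l3.+1 p3),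
    glues g1 l1 p1 g2 l2 p2 g12 l12.+1 p12 ->
    glues g2 l2 p2 g3 l3 p3 g23 l23.+1 p23 ->
    glues g12 l12 p12 g3 l3 p3 g l p ->
    j != ord0 -> m = leg_r i j :> nat ->
    comp g l p m (comp g12 l12.+1 p12 i a b) c =
      comp g l p i a (comp g23 l23.+1 p23 j b c);
  comp_par : forall g1 l1 p1 g2 l2 p2 g3 l3 p3 g12 l12 p12 g13 l13 p13 g l p
      (i j : 'I_l1.+2) (m : 'I_l12.+1) (n : 'I_l13.+1)
      (a : car g1 l1.+2 p1) (b : car g2 l2.+1 p2) (c : car g3 l3.+1 p3),
    glues g1 l1.+1 p1 g2 l2 p2 g12 l12.+1 p12 ->
    glues g1 l1.+1 p1 g3 l3 p3 g13 l13.+1 p13 ->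
    glues g12 l12 p12 g3 l3 p3 g l p ->
    i != j -> m = leg_l l2 i j :> nat -> n = leg_l l3 j i :> nat ->
    comp g l p m (comp g12 l12.+1 p12 i a b) c =
      (-1) ^ (p2 * p3) *: comp g l p n (comp g13 l13.+1 p13 j a c) b;

  contr_sym : forall g l p i j (a : car g l.+2 p),
    contr g p i j a = contr g p j i a;
  contr_act : forall g l p (i j : 'I_l.+2) (s : 'S_l.+2) (r : 'S_l)
      (a : car g l.+2 p), i != j ->
    (forall (x : 'I_l.+2) (z : 'I_l), x != i -> x != j ->
       z = leg_c i j x :> nat -> r z = leg_c (s i) (s j) (s x) :> nat) ->
    contr g p (s i) (s j) (act g p s a) = act g.+1 p r (contr g p i j a);
  contr_comm : forall g l p (i j m n : 'I_l.+4) (i' j' m' n' : 'I_l.+2)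
      (a : car g l.+4 p),
    uniq [:: i; j; m; n] ->
    m' = leg_c i j m :> nat -> n' = leg_c i j n :> nat ->
    i' = leg_c m n i :> nat -> j' = leg_c m n j :> nat ->
    contr g.+1 p m' n' (contr g p i j a) = contr g.+1 p i' j' (contr g p m n a);

  contr_comp : forall g1 l1 p1 g2 l2 p2 g l p (i x y : 'I_l1.+3)
      (i' : 'I_l1.+1) (m n : 'I_l.+2)
      (a : car g1 l1.+3 p1) (b : car g2 l2.+1 p2),
    glues g1 l1.+2 p1 g2 l2 p2 g l.+2 p -> uniq [:: i; x; y] ->
    m = leg_l l2 i x :> nat -> n = leg_l l2 i y :> nat ->
    i' = leg_c x y i :> nat ->
    contr g p m n (comp g l.+2 p i a b) =
      comp g.+1 l p i' (contr g1 p1 x y a) b;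
  (* Two edges join a and b: i to 0 and x to y.  Either can be contracted
     first; t moves the leg y of b to 0. *)
  contr_comp_swap : forall g1 l1 p1 g2 l2 p2 g l p (i x : 'I_l1.+1)
      (y : 'I_l2.+1) (t : 'S_l2.+1) (m n m' n' : 'I_l.+2) (r : 'S_l)
      (a : car g1 l1.+1 p1) (b : car g2 l2.+1 p2),
    glues g1 l1 p1 g2 l2 p2 g l.+2 p -> i != x -> y != ord0 -> t y = ord0 ->
    m = leg_l l2 i x :> nat -> n = leg_r i y :> nat ->
    m' = leg_l l2 x i :> nat -> n' = leg_r x (t ord0) :> nat ->
    (forall (u : 'I_l1.+1) (z : 'I_l), u != i -> u != x ->
       z = leg_c m n (leg_l l2 i u) :> nat ->
       r z = leg_c m' n' (leg_l l2 x u) :> nat) ->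
    (forall (v : 'I_l2.+1) (z : 'I_l), v != ord0 -> v != y ->
       z = leg_c m n (leg_r i v) :> nat ->
       r z = leg_c m' n' (leg_r x (t v)) :> nat) ->
    act g.+1 p r (contr g p m n (comp g l.+2 p i a b)) =
      contr g p m' n' (comp g l.+2 p x a (act g2 p2 t b))
}.
Arguments act {k m0 g l p} s.
Arguments comp {k m0 g1 l1 p1 g2 l2 p2} g l p i a b.
Arguments contr {k m0 g l p} i j.

Section HomologyOperad.
Variables (k : fieldType) (P : modop k).

Let hcar g l := homology_complex (P g l).

Lemma act_cycle g l p s (a : P g l p) :
  a \in @is_cycle k (P g l) p -> act s a \in @is_cycle k (P g l) p.
Proof. by move=> /is_cycleP ca; apply/is_cycleP => q; rewrite act_diff ca linear0. Qed.

Lemma act_boundary g l p s (b : P g l (p + 1)) :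
  exists z, diff (p + 1) p z = act s (diff (p + 1) p b).
Proof. by exists (act s b); rewrite act_diff. Qed.

Lemma contr_cycle g l p i j (a : P g l.+2 p) :
  a \in @is_cycle k (P g l.+2) p -> contr i j a \in @is_cycle k (P g.+1 l) p.
Proof. by move=> /is_cycleP ca; apply/is_cycleP => q; rewrite contr_diff ca linear0. Qed.

Lemma contr_boundary g l p i j (b : P g l.+2 (p + 1)) :
  exists z, diff (p + 1) p z = contr i j (diff (p + 1) p b).
Proof. by exists (contr i j b); rewrite contr_diff. Qed.

Lemma comp0l g1 l1 p1 g2 l2 p2 g l p i (b : P g2 l2.+1 p2) :
  comp g l p i (0 : P g1 l1.+1 p1) b = 0.
Proof. exact: linear0 (mk_linear (comp_linear_l g l p i b)). Qed.

Lemma comp0r g1 l1 p1 g2 l2 p2 g l p i (a : P g1 l1.+1 p1) :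
  comp g l p i a (0 : P g2 l2.+1 p2) = 0.
Proof. exact: linear0 (mk_linear (comp_linear_r g l p i a)). Qed.

Lemma compBl g1 l1 p1 g2 l2 p2 g l p i (a a' : P g1 l1.+1 p1)
    (b : P g2 l2.+1 p2) :
  comp g l p i (a - a') b = comp g l p i a b - comp g l p i a' b.
Proof. exact: linearB (mk_linear (comp_linear_l g l p i b)) _ _. Qed.

Lemma compBr g1 l1 p1 g2 l2 p2 g l p i (a : P g1 l1.+1 p1)
    (b b' : P g2 l2.+1 p2) :
  comp g l p i a (b - b') = comp g l p i a b - comp g l p i a b'.
Proof. exact: linearB (mk_linear (comp_linear_r g l p i a)) _ _. Qed.

Lemma compZl g1 l1 p1 g2 l2 p2 g l p i c (a : P g1 l1.+1 p1)
    (b : P g2 l2.+1 p2) :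
  comp g l p i (c *: a) b = c *: comp g l p i a b.
Proof. exact: linearZZ (mk_linear (comp_linear_l g l p i b)) _ _. Qed.

Lemma compZr g1 l1 p1 g2 l2 p2 g l p i c (a : P g1 l1.+1 p1)
    (b : P g2 l2.+1 p2) :
  comp g l p i a (c *: b) = c *: comp g l p i a b.
Proof. exact: linearZZ (mk_linear (comp_linear_r g l p i a)) _ _. Qed.

Lemma comp_cycle g1 l1 p1 g2 l2 p2 g l p i
    (a : P g1 l1.+1 p1) (b : P g2 l2.+1 p2) :
  a \in @is_cycle k (P g1 l1.+1) p1 -> b \in @is_cycle k (P g2 l2.+1) p2 ->
  comp g l p i a b \in @is_cycle k (P g l) p.
Proof.
move=> /is_cycleP ca /is_cycleP cb.
case gl : (glues g1 l1 p1 g2 l2 p2 g l p); last first.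
  by rewrite comp_dead ?gl // rpred0.
rewrite unfold_in /is_cycle.
rewrite (@comp_diff _ _ _ _ _ (p1 - 1) _ _ _ (p2 - 1)) ?subrK //.
by rewrite ca cb comp0l comp0r scaler0 addr0.
Qed.

Lemma comp_boundary_l g1 l1 p1 g2 l2 p2 g l p i
    (a : P g1 l1.+1 (p1 + 1)) (b : P g2 l2.+1 p2) :
  b \in @is_cycle k (P g2 l2.+1) p2 ->
  exists z, diff (p + 1) p z = comp g l p i (diff (p1 + 1) p1 a) b.
Proof.
move=> /is_cycleP cb.
case gl : (glues g1 l1 p1 g2 l2 p2 g l p); last first.
  by exists 0; rewrite linear0 comp_dead ?gl.
exists (comp g l (p + 1) i a b).
rewrite (@comp_diff _ _ _ _ _ p1 _ _ _ (p2 - 1)) ?subrK //.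
  by rewrite cb comp0r scaler0 addr0.
by move: gl => /and3P [/eqP -> /eqP -> /eqP ->]; rewrite /glues !eqxx addrAC /=.
Qed.

Lemma comp_boundary_r g1 l1 p1 g2 l2 p2 g l p i
    (a : P g1 l1.+1 p1) (b : P g2 l2.+1 (p2 + 1)) :
  a \in @is_cycle k (P g1 l1.+1) p1 ->
  exists z, diff (p + 1) p z = comp g l p i a (diff (p2 + 1) p2 b).
Proof.
move=> /is_cycleP ca.
case gl : (glues g1 l1 p1 g2 l2 p2 g l p); last first.
  by exists 0; rewrite linear0 comp_dead ?gl.
exists ((-1) ^ p1 *: comp g l (p + 1) i a b); rewrite linearZ /=.
rewrite (@comp_diff _ _ _ _ _ (p1 - 1) _ _ _ p2) ?subrK //.
  by rewrite ca comp0l add0r scalerA -expfzMl mulrNN mulr1 exp1rz scale1r.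
by move: gl => /and3P [/eqP -> /eqP -> /eqP ->]; rewrite /glues !eqxx addrA /=.
Qed.

Definition homology_act g l p (s : 'S_l) :
    {linear hcar g l p -> hcar g l p} :=
  homology_map (@act_cycle g l p s) (@act_boundary g l p s).

Definition homology_contr g l p (i j : 'I_l.+2) :
    {linear hcar g l.+2 p -> hcar g.+1 l p} :=
  homology_map (@contr_cycle g l p i j) (@contr_boundary g l p i j).

Definition homology_comp g1 l1 p1 g2 l2 p2 g l p (i : 'I_l1.+1)
    (x : hcar g1 l1.+1 p1) (y : hcar g2 l2.+1 p2) : hcar g l p :=
  cls (comp g l p i (rep x) (rep y)).

Lemma homology_actE g l p s (a : P g l p) :
  a \in @is_cycle k (P g l) p -> homology_act g p s (cls a) = cls (act s a).
Proof. exact: homology_mapE (@act_cycle g l p s) (@act_boundary g l p s) _. Qed.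

Lemma homology_contrE g l p i j (a : P g l.+2 p) :
  a \in @is_cycle k (P g l.+2) p ->
  homology_contr g p i j (cls a) = cls (contr i j a).
Proof.
exact: homology_mapE (@contr_cycle g l p i j) (@contr_boundary g l p i j) _.
Qed.

Lemma homology_compE g1 l1 p1 g2 l2 p2 g l p i
    (a : P g1 l1.+1 p1) (b : P g2 l2.+1 p2) :
  a \in @is_cycle k (P g1 l1.+1) p1 -> b \in @is_cycle k (P g2 l2.+1) p2 ->
  homology_comp g l p i (cls a) (cls b) = cls (comp g l p i a b).
Proof.
move=> ca cb; apply/cls_eq; rewrite ?comp_cycle ?rep_cycle //.
have [a' da] := rep_cls ca; have [b' db] := rep_cls cb.
have [u du] := comp_boundary_l g l p i a' (rep_cycle (cls b)).
have [v dv] := comp_boundary_r g l p i b' ca.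
exists (u + v); rewrite linearD /= du dv da db compBl compBr.
by rewrite addrA subrK.
Qed.

Lemma comp_linear_l_cycle g1 l1 p1 g2 l2 p2 g l p i (y : hcar g2 l2.+1 p2) :
  linear (fun x : hcar g1 l1.+1 p1 => homology_comp g l p i x y).
Proof.
move=> c x x'; have [b cb ->] := clsP y.
have [a ca ->] := clsP x; have [a' ca' ->] := clsP x'.
rewrite -cls_linear // !homology_compE ?rpredD ?rpredZ //.
by rewrite -cls_linear ?comp_cycle // comp_linear_l.
Qed.

Lemma comp_linear_r_cycle g1 l1 p1 g2 l2 p2 g l p i (x : hcar g1 l1.+1 p1) :
  linear (fun y : hcar g2 l2.+1 p2 => homology_comp g l p i x y).
Proof.
move=> c y y'; have [a ca ->] := clsP x.
have [b cb ->] := clsP y; have [b' cb' ->] := clsP y'.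
rewrite -cls_linear // !homology_compE ?rpredD ?rpredZ //.
by rewrite -cls_linear ?comp_cycle // comp_linear_r.
Qed.

Definition homology_modop : modop k.
Proof.
refine (@Modop k hcar _ homology_act homology_comp homology_contr
          _ _ _ _ _ _ _ _ _ _ _ _ _ _ _ _ _ _).
- move=> g l p x st; have [a ca ->] := clsP x.
  by rewrite (car_unstable a st) cls0.
- move=> g l p x; have [a ca ->] := clsP x.
  by rewrite homology_actE // act1.
- move=> g l p s t x; have [a ca ->] := clsP x.
  by rewrite !homology_actE ?act_cycle // actM.
- by move=> g l p q s x; apply/esym; exact: linear0 (homology_act g q s).
- move=> g1 l1 p1 g2 l2 p2 g l p i x y gl.
  by rewrite /homology_comp comp_dead // cls0.
- exact: comp_linear_l_cycle.
- exact: comp_linear_r_cycle.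
- move=> g1 l1 p1 q1 g2 l2 p2 q2 g l p q i x y _ _ _ _.
  have -> : homology_comp g l q i (diff p1 q1 x) y = 0.
    exact: linear0 (mk_linear (comp_linear_l_cycle g l q i y)).
  have -> : homology_comp g l q i x (diff p2 q2 y) = 0.
    exact: linear0 (mk_linear (comp_linear_r_cycle g l q i x)).
  by rewrite scaler0 addr0.
- move=> g l p i x; have [a ca ->] := clsP x.
  by rewrite homology_contrE // contr_dead cls0.
- by move=> g l p q i j x; apply/esym; exact: linear0 (homology_contr g q i j).
- move=> g1 l1 p1 g2 l2 p2 g l p i s t r x y gl t0 rl rr.
  have [a ca ->] := clsP x; have [b cb ->] := clsP y.
  rewrite (homology_actE s ca) (homology_actE t cb).
  rewrite !homology_compE ?act_cycle //.
  by rewrite homology_actE ?comp_cycle // (comp_act _ _ gl t0 rl rr).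
- move=> g1 l1 p1 g2 l2 p2 g l p i s r x y gl s0 rl rr.
  have [a ca ->] := clsP x; have [b cb ->] := clsP y.
  rewrite (homology_actE s ca) !homology_compE ?act_cycle //.
  rewrite homology_actE ?comp_cycle // (comp_comm _ _ gl s0 rl rr).
  by rewrite clsZ ?comp_cycle ?act_cycle.
- move=> g1 l1 p1 g2 l2 p2 g3 l3 p3 g12 l12 p12 g23 l23 p23 g l p i j m x y z.
  move=> gl gl' gl'' j0 mE.
  have [a ca ->] := clsP x; have [b cb ->] := clsP y; have [c cc ->] := clsP z.
  rewrite !homology_compE ?comp_cycle //.
  by rewrite (comp_assoc _ _ _ gl gl' gl'' j0 mE).
- move=> g1 l1 p1 g2 l2 p2 g3 l3 p3 g12 l12 p12 g13 l13 p13 g l p i j m n x y z.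
  move=> gl gl' gl'' ij mE nE.
  have [a ca ->] := clsP x; have [b cb ->] := clsP y; have [c cc ->] := clsP z.
  rewrite !homology_compE ?comp_cycle // (comp_par _ _ _ gl gl' gl'' ij mE nE).
  by rewrite clsZ ?comp_cycle.
- move=> g l p i j x; have [a ca ->] := clsP x.
  by rewrite !homology_contrE // contr_sym.
- move=> g l p i j s r x ij rE; have [a ca ->] := clsP x.
  rewrite (homology_actE s ca) !homology_contrE ?act_cycle //.
  by rewrite homology_actE ?contr_cycle // (contr_act _ ij rE).
- move=> g l p i j m n i' j' m' n' x u mE nE iE jE; have [a ca ->] := clsP x.
  rewrite (homology_contrE i j ca) (homology_contrE m n ca).
  by rewrite !homology_contrE ?contr_cycle // (contr_comm _ u mE nE iE jE).
- move=> g1 l1 p1 g2 l2 p2 g l p i x y i' m n x' y' gl u mE nE iE.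
  have [a ca ->] := clsP x'; have [b cb ->] := clsP y'.
  rewrite (homology_contrE x y ca) !homology_compE ?contr_cycle //.
  by rewrite homology_contrE ?comp_cycle // (contr_comp _ _ gl u mE nE iE).
- move=> g1 l1 p1 g2 l2 p2 g l p i x y t m n m' n' r x' y'.
  move=> gl ix y0 ty mE nE mE' nE' ru rv.
  have [a ca ->] := clsP x'; have [b cb ->] := clsP y'.
  rewrite (homology_actE t cb) !homology_compE ?act_cycle //.
  rewrite !homology_contrE ?comp_cycle ?act_cycle //.
  rewrite homology_actE ?contr_cycle ?comp_cycle //.
  by rewrite (contr_comp_swap _ _ gl ix y0 ty mE nE mE' nE' ru rv).
Defined.

Lemma act_cls g l p (s : 'S_l) (a : P g l p) :
  a \in @is_cycle k (P g l) p ->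
  act s (cls a : homology_modop g l p) = cls (act s a).
Proof. exact: homology_actE. Qed.

Lemma contr_cls g l p (i j : 'I_l.+2) (a : P g l.+2 p) :
  a \in @is_cycle k (P g l.+2) p ->
  contr i j (cls a : homology_modop g l.+2 p) = cls (contr i j a).
Proof. exact: homology_contrE. Qed.

Lemma comp_cls g1 l1 p1 g2 l2 p2 g l p (i : 'I_l1.+1)
    (a : P g1 l1.+1 p1) (b : P g2 l2.+1 p2) :
  a \in @is_cycle k (P g1 l1.+1) p1 -> b \in @is_cycle k (P g2 l2.+1) p2 ->
  comp g l p i (cls a : homology_modop g1 l1.+1 p1)
               (cls b : homology_modop g2 l2.+1 p2) = cls (comp g l p i a b).
Proof. exact: homology_compE. Qed.

End HomologyOperad.

Record mhom (k : fieldType) (P Q : modop k) := Mhom {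
  mapp :> forall g l p, {linear P g l p -> Q g l p};
  mhom_diff : forall g l p q (a : P g l p),
    mapp g l q (diff p q a) = diff p q (mapp g l p a);
  mhom_act : forall g l p (s : 'S_l) (a : P g l p),
    mapp g l p (act s a) = act s (mapp g l p a);
  mhom_comp : forall g1 l1 p1 g2 l2 p2 g l p (i : 'I_l1.+1)
      (a : P g1 l1.+1 p1) (b : P g2 l2.+1 p2),
    mapp g l p (comp g l p i a b) =
      comp g l p i (mapp g1 l1.+1 p1 a) (mapp g2 l2.+1 p2 b);
  mhom_contr : forall g l p (i j : 'I_l.+2) (a : P g l.+2 p),
    mapp g.+1 l p (contr i j a) = contr i j (mapp g l.+2 p a)
}.

Definition is_aut (k : fieldType) (P : modop k) (f : mhom P P) : Prop :=
  exists f' : mhom P P, forall g l p, cancel (f g l p) (f' g l p)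
                                   /\ cancel (f' g l p) (f g l p).

Section HomologyMorphism.
Variables (k : fieldType) (P Q : modop k) (f : mhom P Q).

Lemma mhom_cycle g l p (a : P g l p) :
  a \in @is_cycle k (P g l) p -> f g l p a \in @is_cycle k (Q g l) p.
Proof. by move=> /is_cycleP ca; apply/is_cycleP => q; rewrite -mhom_diff ca linear0. Qed.

Lemma mhom_boundary g l p (b : P g l (p + 1)) :
  exists z, diff (p + 1) p z = f g l p (diff (p + 1) p b).
Proof. by exists (f g l (p + 1) b); rewrite mhom_diff. Qed.

Definition homology_mapp g l p :
    {linear homology_modop P g l p -> homology_modop Q g l p} :=
  homology_map (@mhom_cycle g l p) (@mhom_boundary g l p).

Lemma homology_mappE g l p (a : P g l p) :
  a \in @is_cycle k (P g l) p -> homology_mapp g l p (cls a) = cls (f g l p a).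
Proof. exact: homology_mapE (@mhom_cycle g l p) (@mhom_boundary g l p) _. Qed.

Definition homology_mhom : mhom (homology_modop P) (homology_modop Q).
Proof.
refine (@Mhom k (homology_modop P) (homology_modop Q) homology_mapp _ _ _ _).
- by move=> g l p q x; exact: linear0 (homology_mapp g l q).
- move=> g l p s x; have [a ca ->] := clsP x.
  rewrite (act_cls s ca) (homology_mappE ca) act_cls ?mhom_cycle //.
  by rewrite homology_mappE ?act_cycle // mhom_act.
- move=> g1 l1 p1 g2 l2 p2 g l p i x y.
  have [a ca ->] := clsP x; have [b cb ->] := clsP y.
  rewrite (homology_mappE ca) (homology_mappE cb) !comp_cls ?mhom_cycle //.
  by rewrite homology_mappE ?comp_cycle // mhom_comp.
- move=> g l p i j x; have [a ca ->] := clsP x.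
  rewrite (contr_cls i j ca) (homology_mappE ca) contr_cls ?mhom_cycle //.
  by rewrite homology_mappE ?contr_cycle // mhom_contr.
Defined.

Definition weak_equivalence : Prop :=
  forall g l p, bijective (homology_mhom g l p).

End HomologyMorphism.

Inductive zigzag (k : fieldType) (P : modop k) : modop k -> Type :=
| zigzag_refl : zigzag P P
| zigzag_forward Q R (w : mhom Q R) :
    zigzag P Q -> weak_equivalence w -> zigzag P R
| zigzag_backward Q R (w : mhom R Q) :
    zigzag P Q -> weak_equivalence w -> zigzag P R.

Lemma weak_equivalence_surj (k : fieldType) (P Q : modop k) (w : mhom P Q)
    g l p (y : homology_modop Q g l p) :
  weak_equivalence w -> exists x, homology_mhom w g l p x == y.
Proof. by move=> /(_ g l p) [w' _ wK]; exists (w' y); rewrite wK. Qed.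

Definition homology_inv (k : fieldType) (P Q : modop k) (w : mhom P Q)
    (hw : weak_equivalence w) g l p (y : homology_modop Q g l p) :
    homology_modop P g l p :=
  xchoose (weak_equivalence_surj y hw).

(* The identification HP = HQ given by a zigzag. *)
Fixpoint zigzag_homology (k : fieldType) (P Q : modop k) (z : zigzag P Q) :
    forall g l p, homology_modop P g l p -> homology_modop Q g l p :=
  match z with
  | zigzag_refl => fun g l p x => x
  | zigzag_forward _ _ w z' _ =>
      fun g l p x => homology_mhom w g l p (zigzag_homology z' x)
  | zigzag_backward _ _ w z' hw =>
      fun g l p x => homology_inv hw (zigzag_homology z' x)
  end.

Definition weakly_equivalent (k : fieldType) (P Q : modop k) : Prop :=
  inhabited (zigzag P Q).

Definition formal (k : fieldType) (P : modop k) : Prop :=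
  weakly_equivalent P (homology_modop P).

(* Hf = psi under the identification of HP' with HP given by z. *)
Definition induces (k : fieldType) (P P' : modop k) (z : zigzag P' P)
    (f : mhom P' P') (psi : mhom (homology_modop P) (homology_modop P)) : Prop :=
  forall g l p (x : homology_modop P' g l p),
    zigzag_homology z (homology_mhom f g l p x) =
      psi g l p (zigzag_homology z x).

(* Each HP((g,l)), i.e. the direct sum of the H_p P((g,l)) over all p, is
   finite dimensional. *)
Definition finite_type_homology (k : fieldType) (P : modop k) : Prop :=
  forall g l, (forall p, finite_dim (homology_modop P g l p)) /\
    exists N : nat, forall p, (N < `|p|)%N ->
      forall x : homology_modop P g l p, x = 0.

Section GradingAutomorphism.
Variables (k : fieldType) (P : modop k) (alpha : k).
Hypothesis alpha_neq0 : alpha != 0.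

Definition grading_mapp g l p :
    {linear homology_modop P g l p -> homology_modop P g l p} :=
  GRing.scale (alpha ^ p).

Definition grading_mhom : mhom (homology_modop P) (homology_modop P).
Proof.
refine (@Mhom k (homology_modop P) (homology_modop P) grading_mapp _ _ _ _).
- by move=> g l p q a; exact: linear0 (grading_mapp g l q).
- by move=> g l p s a; rewrite /grading_mapp linearZ.
- move=> g1 l1 p1 g2 l2 p2 g l p i a b; rewrite /grading_mapp.
  case gl : (glues g1 l1 p1 g2 l2 p2 g l p); last first.
    by rewrite !comp_dead ?gl // linear0.
  have /and3P [_ _ /eqP ->] := gl.
  transitivity (alpha ^ p1 *: (alpha ^ p2 *: comp g l (p1 + p2) i a b)).
    by rewrite scalerA -expfzDr.
  by rewrite -compZr -compZl.
- by move=> g l p i j a; rewrite /grading_mapp linearZ.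
Defined.

End GradingAutomorphism.

(* A group morphism from a subgroup of the units of kbar to Z; the values of
   weight outside of weight_dom are irrelevant. *)
Record weight_function (kbar : fieldType) := WeightFunction {
  weight_dom : kbar -> Prop;
  weight : kbar -> int;
  weight_dom_neq0 : forall x, weight_dom x -> x != 0;
  weight_dom1 : weight_dom 1;
  weight_domM : forall x y, weight_dom x -> weight_dom y -> weight_dom (x * y);
  weight_domV : forall x, weight_dom x -> weight_dom x^-1;
  weightM : forall x y, weight_dom x -> weight_dom y ->
    weight (x * y) = weight x + weight y
}.

Definition pure_of_weight (k kbar : fieldType) (iota : {rmorphism k -> kbar})
    (w : weight_function kbar) (V : lmodType k) (f : {linear V -> V})
    (n : int) : Prop :=
  exists2 chi : {poly k}, is_char_poly f chi &
    forall x : kbar, root (map_poly iota chi) x ->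
      weight_dom w x /\ weight w x = n.

Definition pure (k kbar : fieldType) (iota : {rmorphism k -> kbar})
    (w : weight_function kbar) (P : modop k) (f : mhom P P) : Prop :=
  forall g l p, pure_of_weight iota w (homology_mhom f g l p) p.

(* Main.v *)
(* The implications (1) => (2) => (3) => (4) transport automorphisms along the
   zigzags.  For (4) => (1), let f be a pure endomorphism of P.

   Suppose first that q(f) is onto for every polynomial q with q(0) <> 0.  Let
   F_m be the set of x killed by some q(f) all of whose roots have weight at
   most m; it is a multiplicative filtration.  Since H_p is pure of weight p, a
   class in H_p lifts to a cycle in F_p, and a cycle in F_(p-1) of degree p is a
   boundary.  Hence the sums y + z, with y in F_(p-1) and z a cycle in F_p, form
   a suboperad T with weak equivalences P <- T -> HP, the second one sending
   y + z to the class of z.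

   In general, P is replaced by the operad of sequences c_0, c_1, ... of paths
   in P tensored with k[s, ds] such that c_(n+1)(0) = f(c_n(1)).  The map
   c |-> c_0(0) is a weak equivalence to P, under which the shift of sequences
   corresponds to f up to homotopy, and q(shift) is onto when q(0) <> 0 because
   linear recurrences can be solved. *)

From HB Require Import structures.
From mathcomp Require Import all_boot all_order all_algebra all_fingroup.
From mathcomp Require Import boolp functions.
Require Import Defs.

Set Implicit Arguments.
Unset Strict Implicit.
Unset Printing Implicit Defensive.

Import Order.TTheory GRing.Theory Num.Theory.
Local Open Scope ring_scope.

(** * Polynomials acting on a module *)

(** The complexes P((g,l)) need not be finite dimensional, so f has a weight decomposition on
    homology but not on chains. Torsion elements replace generalized eigenspaces, and surjectivity
    of the operators q(f) is what lets spectral information on homology be lifted to chains. If P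
    did split into parts C^n of weight n, each C^n would have homology in degree n only, and T would
    be the sum over n of the truncations of C^n that keep all degrees above n and the cycles in
    degree n. The constant sequences x, f x, f^2 x, ... already satisfy the joining condition, but
    they only give a copy of P on which the shift is f itself. Paths let consecutive terms differ by
    a homotopy, and this slack is what makes the recurrences solvable. The algebra k[s, ds] is
    commutative, so that tensoring with it preserves operads; characteristic zero provides
    primitives and makes a path of zero derivative constant. *)

Section PolyAction.
Variables (k : fieldType) (V : lmodType k) (f : {linear V -> V}).

(** A sum of iterates instead of [horner_mx], because V may have infinite dimension. *)
Definition poly_act (q : {poly k}) (x : V) : V :=
  \sum_(i < size q) q`_i *: iter i f x.

Lemma poly_act_widen n (q : {poly k}) x : (size q <= n)%N ->
  poly_act q x = \sum_(i < n) q`_i *: iter i f x.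
Proof.
move=> le_n; rewrite /poly_act (big_ord_widen n (fun i => q`_i *: iter i f x)) //.
rewrite big_mkcond; apply: eq_bigr => i _; case: ltnP => // le_i.
by rewrite nth_default ?scale0r.
Qed.

Lemma iter_linear i a x y :
  iter i f (a *: x + y) = a *: iter i f x + iter i f y.
Proof. by elim: i => //= i ->; rewrite linearP. Qed.

Lemma poly_act_linear q : linear (poly_act q).
Proof.
move=> a x y; rewrite /poly_act scaler_sumr -big_split; apply: eq_bigr => i _.
by rewrite iter_linear scalerDr !scalerA mulrC.
Qed.
HB.instance Definition _ q :=
  GRing.isLinear.Build k V V *:%R (poly_act q) (poly_act_linear q).

Lemma poly_actD (p q : {poly k}) x : poly_act (p + q) x = poly_act p x + poly_act q x.
Proof.
rewrite (poly_act_widen x (leq_maxl (size p) (size q))).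
rewrite (poly_act_widen x (leq_maxr (size p) (size q))).
rewrite (poly_act_widen x (size_polyD p q)) -big_split; apply: eq_bigr => i _.
by rewrite coefD scalerDl.
Qed.

Lemma poly_actZ a (q : {poly k}) x : poly_act (a *: q) x = a *: poly_act q x.
Proof.
rewrite (poly_act_widen x (size_scale_leq a q)) scaler_sumr; apply: eq_bigr => i _.
by rewrite coefZ scalerA.
Qed.

Lemma poly_actC a x : poly_act a%:P x = a *: x.
Proof. by rewrite (poly_act_widen x (size_polyC_leq1 a)) big_ord1 coefC. Qed.

Lemma poly_actMX (q : {poly k}) x : poly_act (q * 'X) x = poly_act q (f x).
Proof.
have le_s : (size (q * 'X)%R <= (size q).+1)%N.
  by rewrite (leq_trans (size_polyMleq _ _)) // size_polyX addn2.
rewrite (poly_act_widen x le_s) big_ord_recl coefMX eqxx scale0r add0r.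
by apply: eq_bigr => i _; rewrite coefMX /= -iterSr.
Qed.

Lemma poly_act1 x : poly_act 1 x = x.
Proof. by rewrite poly_actC scale1r. Qed.

Lemma poly_actX x : poly_act 'X x = f x.
Proof. by rewrite -[X in poly_act X]mul1r poly_actMX poly_act1. Qed.

Lemma poly_act_comm q x : poly_act q (f x) = f (poly_act q x).
Proof.
rewrite /poly_act linear_sum; apply: eq_bigr => i _.
by rewrite linearZ /= -iterSr.
Qed.

Lemma poly_actM (p q : {poly k}) x : poly_act (p * q) x = poly_act p (poly_act q x).
Proof.
elim/poly_ind: p x => [|p a IH] x.
  by rewrite mul0r -[0]/(0%:P) !poly_actC !scale0r.
rewrite mulrDl !poly_actD mul_polyC poly_actZ poly_actC -mulrA (mulrC 'X) mulrA.
by rewrite !poly_actMX IH poly_act_comm.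
Qed.

End PolyAction.

Lemma poly_act_morph (k : fieldType) (V W : lmodType k) (f : {linear V -> V})
    (f' : {linear W -> W}) (g : {linear V -> W}) q x :
  (forall y, g (f y) = f' (g y)) -> g (poly_act f q x) = poly_act f' q (g x).
Proof.
move=> gf; rewrite /poly_act linear_sum; apply: eq_bigr => i _.
by rewrite linearZ /=; congr (_ *: _); elim: (val i) => //= n <-.
Qed.

Section MatrixAction.
Variables (k : fieldType).

Lemma poly_act_mulmxr m n (A : 'M[k]_n.+1) q (X : 'M[k]_(m, n.+1)) :
  poly_act (mulmxr A) q X = X *m horner_mx A q.
Proof.
elim/poly_ind: q X => [|q a IH] X.
  by rewrite -[0]/(0%:P) poly_actC horner_mx_C !scale0r raddf0 mulmx0.
rewrite poly_actD poly_actMX poly_actC IH rmorphD rmorphM /= horner_mx_X.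
rewrite horner_mx_C mulmxDr mul_mx_scalar -mulmxA; congr (X *m _ + _).
by apply: comm_mx_horner.
Qed.

Lemma char_poly_act m n (A : 'M[k]_n) (X : 'M[k]_(m, n)) :
  poly_act (mulmxr A) (char_poly A) X = 0.
Proof.
case: n A X => [|n] A X; first by apply/matrixP => i [].
by rewrite poly_act_mulmxr Cayley_Hamilton mulmx0.
Qed.

Lemma char_poly_kills (V : lmodType k) (f : {linear V -> V}) chi v :
  is_char_poly f chi -> poly_act f chi v = 0.
Proof.
move=> [n [e [A [[e' _ eK] fe ->]]]]; rewrite -(eK v).
rewrite -(poly_act_morph (f := mulmxr A)) ?char_poly_act ?linear0 //.
Qed.

(** A torsion element lives in a cyclic submodule, where f is modelled by a companion matrix. The
    family [e] only has to span, so q need not be the minimal annihilator of x. *)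
Lemma companion_span (V : lmodType k) (f : {linear V -> V}) (q : {poly k}) x :
  q \is monic -> poly_act f q x = 0 ->
  exists n (A : 'M[k]_n) (u : 'rV[k]_n) (e : 'I_n -> V),
    [/\ char_poly A = q, forall i, f (e i) = \sum_j A i j *: e j
      & x = \sum_i u 0 i *: e i].
Proof.
move=> q_mon qx; have q_gt0 : (0 < size q)%N.
  by rewrite lt0n size_poly_eq0 monic_neq0.
have sz : size q = (size q).-1.+1 by rewrite prednK.
exists _, (companionmx q), (\row_i (i == 0 :> nat)%:R), (fun i => iter i f x).
split=> [|i|]; first exact: companionmxK.
- have [i_last|i_notlast] := eqVneq (i : nat) (size q).-1.-1.
    have e_i : i.+1 = (size q).-1.
      by rewrite i_last prednK // (leq_ltn_trans _ (ltn_ord i)).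
    have -> : f (iter i f x) = iter (size q).-1 f x.
      by rewrite -iterS; congr (iter _ f x).
    (* The last row of the companion matrix is the relation q(f) x = 0 solved for its leading
       term. *)
    move: qx; rewrite (poly_act_widen f x (eq_leq sz)) big_ord_recr /=.
    rewrite -/(lead_coef q) (monicP q_mon) scale1r addrC => /eqP.
    rewrite addr_eq0 => /eqP ->; rewrite -sumrN; apply: eq_bigr => j _.
    by rewrite mxE i_last eqxx scaleNr.
  have lt_i : (i.+1 < (size q).-1)%N.
    rewrite ltn_neqAle ltn_ord andbT; apply: contra i_notlast => /eqP ei.
    by apply/eqP; exact: (congr1 predn ei).
  rewrite (bigD1 (Ordinal lt_i)) //= mxE (negPf i_notlast) eqxx scale1r.
  rewrite big1 ?addr0 // => j; rewrite mxE (negPf i_notlast) eq_sym => /negPf.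
  by rewrite -val_eqE /= => ->; rewrite scale0r.
- have [lt0|] := ltnP 0 (size q).-1.
    rewrite (bigD1 (Ordinal lt0)) //= mxE eqxx scale1r big1 ?addr0 // => j.
    by rewrite -val_eqE mxE /= => /negPf ->; rewrite scale0r.
  (* Here q = 1: the family is empty, and x = q(g) x = 0 with g = f. *)
  rewrite leqn0 => /eqP q0; have q1 : size q = 1%N by rewrite sz q0.
  have -> : x = 0.
    move: q_mon qx; rewrite monicE /lead_coef q1 /= => /eqP q_lead.
    by rewrite (size1_polyC (eq_leq q1)) q_lead poly_act1.
  by rewrite big1 // => -[j]; rewrite q0.
Qed.

End MatrixAction.

(** Linear factors are stripped from q until the remaining factor no longer kills x; what it makes
    of x is then an eigenvector. Its form r(g) x matters: an operator commuting with g treats it as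
    it treats x. *)
Lemma poly_act_eigenvector (K : closedFieldType) (V : lmodType K)
    (g : {linear V -> V}) q x :
  q != 0 -> x != 0 -> poly_act g q x = 0 ->
  exists b r, [/\ root q b, poly_act g r x != 0
                & g (poly_act g r x) = b *: poly_act g r x].
Proof.
have [n] := ubnP (size q); elim: n q => // n IH q; rewrite ltnS => le_n q0 x0 qx.
have [sz1|] := eqVneq (size q) 1%N.
  move: qx; rewrite (size1_polyC (eq_leq sz1)) poly_actC => /eqP.
  rewrite scaler_eq0 (negPf x0) orbF => /eqP c0.
  by move: q0; rewrite (size1_polyC (eq_leq sz1)) c0 eqxx.
move=> /closed_rootP [b qb]; have /factor_theorem [r qE] := qb.
have r0 : r != 0 by apply: contra q0 => /eqP r0; rewrite qE r0 mul0r.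
have [rx|rx] := eqVneq (poly_act g r x) 0; last first.
  exists b, r; split=> //; apply/eqP; rewrite -subr_eq0; apply/eqP.
  move: qx; rewrite qE mulrC poly_actM poly_actD poly_actX -polyCN poly_actC.
  by rewrite scaleNr.
have le_r : (size r < n)%N.
  by apply: leq_trans le_n; rewrite qE size_Mmonic ?monicXsubC // size_XsubC addn2.
have [b' [r' [rb' r'x e]]] := IH r le_r r0 x0 rx.
by exists b', r'; split=> //; rewrite qE rootM rb'.
Qed.

(** * Elements annihilated by a polynomial with prescribed roots *)

Section Torsion.
Variables (k : fieldType) (K : closedFieldType) (iota : {rmorphism k -> K}).

Definition roots_in (S : K -> Prop) (q : {poly k}) : Prop :=
  q != 0 /\ forall a, root (map_poly iota q) a -> S a.

Lemma roots_inM S (p q : {poly k}) :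
  roots_in S p -> roots_in S q -> roots_in S (p * q).
Proof.
move=> [p0 pS] [q0 qS]; split=> [|a]; first by rewrite mulf_neq0.
by rewrite rmorphM rootM => /orP [/pS|/qS].
Qed.

Lemma roots_in1 S : roots_in S 1.
Proof. by split=> [|a]; rewrite ?oner_neq0 // rmorph1 rootC oner_eq0. Qed.

Lemma roots_in_sub (S S' : K -> Prop) q :
  (forall a, S a -> S' a) -> roots_in S q -> roots_in S' q.
Proof. by move=> sSS [q0 qS]; split=> // a /qS /sSS. Qed.

(** Without a common root in the closed field the polynomials are coprime there, and coprimality
    descends to k. *)
Lemma roots_in_Bezout S S' p q :
  roots_in S p -> roots_in S' q -> (forall a, S a -> ~ S' a) ->
  exists u v, u * p + v * q = 1.
Proof.
move=> [p0 pS] [q0 qS'] dis.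
have : coprimep p q.
  rewrite -(coprimep_map iota); apply/Pdiv.ClosedField.coprimepP => a /pS Sa.
  by apply/negP => /qS' /(dis _ Sa).
by case/Bezout_eq1_coprimepP => -[u v] /= e; exists u, v.
Qed.

(** The annihilator has coefficients in k and only its roots are taken in [K], so no extension of
    scalars of V is required. *)
Definition torsion (S : K -> Prop) (V : lmodType k) (f : {linear V -> V})
    (x : V) : Prop :=
  exists2 q, roots_in S q & poly_act f q x = 0.

Section Sub.
Variables (S : K -> Prop) (V : lmodType k) (f : {linear V -> V}).

Lemma torsion0 : torsion S f 0.
Proof. by exists 1; [exact: roots_in1 | rewrite linear0]. Qed.

Lemma torsion_linear a x y :
  torsion S f x -> torsion S f y -> torsion S f (a *: x + y).
Proof.
move=> [p pS px] [q qS qy]; exists (p * q); first exact: roots_inM.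
by rewrite linearP /= {1}mulrC !poly_actM px qy !linear0 addr0.
Qed.

Lemma torsionD x y : torsion S f x -> torsion S f y -> torsion S f (x + y).
Proof. by rewrite -[x in _ (x + y)]scale1r; exact: torsion_linear. Qed.

Lemma torsionZ a x : torsion S f x -> torsion S f (a *: x).
Proof. by move=> Sx; rewrite -[_ *: _]addr0; apply: torsion_linear torsion0. Qed.

Lemma torsion_sub (S' : K -> Prop) x :
  (forall a, S a -> S' a) -> torsion S f x -> torsion S' f x.
Proof. by move=> sSS [q qS qx]; exists q => //; exact: roots_in_sub qS. Qed.

Lemma torsion_disjoint (S' : K -> Prop) x :
  (forall a, S a -> ~ S' a) -> torsion S f x -> torsion S' f x -> x = 0.
Proof.
move=> dis [p pS px] [q qS qx]; have [u [v e]] := roots_in_Bezout pS qS dis.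
by rewrite -(poly_act1 f x) -e poly_actD !poly_actM px qx !linear0 addr0.
Qed.

End Sub.

Lemma torsion_morph S (V W : lmodType k) (f : {linear V -> V})
    (f' : {linear W -> W}) (g : {linear V -> W}) x :
  (forall y, g (f y) = f' (g y)) -> torsion S f x -> torsion S f' (g x).
Proof.
by move=> gf [q qS qx]; exists q => //; rewrite -(poly_act_morph _ _ gf) qx linear0.
Qed.

(** This is the spectrum of a Kronecker product. Some Y = X r(A2) is an eigenvector of right
    multiplication by A2, with eigenvalue b, and still satisfies the equation of X since left and
    right multiplications commute. Dividing by b leaves Y^T A1 = (c / b) Y^T, so any nonzero vector
    of the row space of Y^T shows that c / b is an eigenvalue of A1. *)
Lemma eigenvalue_kron n1 n2 (A1 : 'M[K]_n1) (A2 : 'M[K]_n2) X c :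
  X != 0 -> A1^T *m X *m A2 = c *: X ->
  (forall b, root (char_poly A2) b -> b != 0) ->
  exists a b, [/\ root (char_poly A1) a, root (char_poly A2) b & c = a * b].
Proof.
move=> X0 eX nz.
have [b [r [rb Y0 eY]]] :=
  poly_act_eigenvector (monic_neq0 (char_poly_monic A2)) X0 (char_poly_act A2 X).
set Y := poly_act _ _ _ in Y0 eY.
pose h : {linear 'M_(n1, n2) -> 'M_(n1, n2)} := mulmx A1^T.
have hY : A1^T *m Y *m A2 = c *: Y.
  have -> : A1^T *m Y = poly_act (mulmxr A2) r (A1^T *m X).
    rewrite -[LHS]/(h Y) -[A1^T *m X]/(h X).
    by apply: poly_act_morph => Z /=; rewrite mulmxA.
  by rewrite -[_ *m A2]/(mulmxr A2 _) -poly_act_comm /= eX linearZ.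
exists (c / b), b; split=> //; last by rewrite divfK ?nz.
have eYT : Y^T *m A1 = (c / b) *: Y^T.
  apply: trmx_inj; rewrite trmx_mul trmxK linearZ /= trmxK.
  apply: (scalerI (nz b rb)); rewrite scalerA mulrC divfK ?nz //.
  by rewrite -hY -mulmxA (_ : Y *m A2 = b *: Y) ?scalemxAr //; exact: eY.
rewrite -eigenvalue_root_char.
have /rowV0Pn [v] : Y^T != 0 by rewrite -trmx0 (inj_eq trmx_inj).
move=> /submxP [D ->] v0; apply/eigenvalueP; exists (D *m Y^T) => //.
by rewrite -mulmxA eYT scalemxAr.
Qed.

(* Both annihilators are characteristic polynomials of companion matrices, and
   the product of the two spans is acted upon by X |-> A1^T X A2. *)
Lemma torsion_bilinear (S1 S2 S3 : K -> Prop) (V1 V2 V3 : lmodType k)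
    (f1 : {linear V1 -> V1}) (f2 : {linear V2 -> V2}) (f3 : {linear V3 -> V3})
    (B : V1 -> V2 -> V3) x y :
  (forall v, linear (B^~ v)) -> (forall u, linear (B u)) ->
  (forall u v, B (f1 u) (f2 v) = f3 (B u v)) ->
  (forall b, S2 b -> b != 0) -> (forall a b, S1 a -> S2 b -> S3 (a * b)) ->
  torsion S1 f1 x -> torsion S2 f2 y -> torsion S3 f3 (B x y).
Proof.
move=> Bl Br Bf nz S12.
have monic_annihilator S (V : lmodType k) (f : {linear V -> V}) v :
    torsion S f v -> exists q, [/\ q \is monic, roots_in S q & poly_act f q v = 0].
  move=> [q [q0 qS] qv]; have l0 : (lead_coef q)^-1 != 0.
    by rewrite invr_eq0 lead_coef_eq0.
  exists ((lead_coef q)^-1 *: q); split; last by rewrite poly_actZ qv scaler0.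
    by rewrite monicE lead_coefZ mulVf ?lead_coef_eq0.
  split=> [|a]; first by rewrite scaler_eq0 negb_or l0.
  by rewrite map_polyZ /= rootZ ?fmorph_eq0 // => /qS.
move=> /monic_annihilator [q1 [m1 [_ r1] e1]].
move=> /monic_annihilator [q2 [m2 [_ r2] e2]].
have [n1 [A1 [u1 [E1 [c1 fE1 xE]]]]] := companion_span m1 e1.
have [n2 [A2 [u2 [E2 [c2 fE2 yE]]]]] := companion_span m2 e2.
pose Bl' v := mk_linear (Bl v); pose Br' u := mk_linear (Br u).
have B_suml I r (P : pred I) F v :
    B (\sum_(i <- r | P i) F i) v = \sum_(i <- r | P i) B (F i) v.
  exact: (linear_sum (Bl' v)).
have B_sumr I r (P : pred I) F u :
    B u (\sum_(i <- r | P i) F i) = \sum_(i <- r | P i) B u (F i).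
  exact: (linear_sum (Br' u)).
have BZl a u v : B (a *: u) v = a *: B u v by exact: (linearZZ (Bl' v)).
have BZr a u v : B u (a *: v) = a *: B u v by exact: (linearZZ (Br' u)).
(* [F] intertwines [L] with [f3] and maps [u1^T *m u2] to [B x y]; by Cayley-Hamilton, [char_poly L]
   therefore kills [B x y]. *)
pose L := lin_mulmx A1^T *m lin_mulmxr A2 : 'M[k]_(n1 * n2).
pose F (X : 'M[k]_(n1, n2)) := \sum_i \sum_j X i j *: B (E1 i) (E2 j).
have F_lin : linear F.
  move=> a X Y; rewrite /F scaler_sumr -big_split; apply: eq_bigr => i _.
  rewrite scaler_sumr -big_split; apply: eq_bigr => j _.
  by rewrite !mxE scalerDl scalerA.
have fF X : f3 (F X) = F (A1^T *m X *m A2).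
  have -> : f3 (F X) =
      \sum_i \sum_j \sum_a \sum_b (X i j * A1 i a * A2 j b) *: B (E1 a) (E2 b).
    rewrite /F linear_sum; apply: eq_bigr => i _.
    rewrite linear_sum; apply: eq_bigr => j _.
    rewrite linearZ /= -Bf fE1 fE2 B_suml scaler_sumr; apply: eq_bigr => a _.
    rewrite B_sumr scaler_sumr; apply: eq_bigr => b _.
    by rewrite BZl BZr !scalerA.
  have -> : F (A1^T *m X *m A2) =
      \sum_a \sum_b \sum_j \sum_i (X i j * A1 i a * A2 j b) *: B (E1 a) (E2 b).
    apply: eq_bigr => a _; apply: eq_bigr => b _.
    rewrite !mxE scaler_suml; apply: eq_bigr => j _.
    rewrite !mxE mulr_suml scaler_suml; apply: eq_bigr => i _.
    by rewrite mxE (mulrC (X i j)).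
  transitivity (\sum_i \sum_a \sum_j \sum_b
      (X i j * A1 i a * A2 j b) *: B (E1 a) (E2 b)).
    by apply: eq_bigr => i _; rewrite exchange_big.
  rewrite exchange_big; apply: eq_bigr => a _.
  transitivity (\sum_i \sum_b \sum_j
      (X i j * A1 i a * A2 j b) *: B (E1 a) (E2 b)).
    by apply: eq_bigr => i _; rewrite exchange_big.
  rewrite exchange_big; apply: eq_bigr => b _.
  by rewrite exchange_big.
have BxyE : B x y = F (u1^T *m u2).
  rewrite xE yE B_suml; apply: eq_bigr => i _.
  rewrite B_sumr; apply: eq_bigr => j _.
  by rewrite BZl BZr scalerA !mxE big_ord1 !mxE.
pose F' := mk_linear (F_lin : linear (F : 'M_(n1, n2) -> V3)).
pose G : {linear 'rV[k]_(n1 * n2) -> V3} := F' \o vec_mx.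
exists (char_poly L).
  split=> [|c]; first exact/monic_neq0/char_poly_monic.
  rewrite map_char_poly -eigenvalue_root_char => /eigenvalueP [v vL v0].
  have LE : map_mx iota L = lin_mulmx (map_mx iota A1)^T *m lin_mulmxr (map_mx iota A2).
    rewrite map_mxM; congr (_ *m _); apply: map_lin_mx => Z /=.
      by rewrite map_mxM map_trmx.
    by rewrite map_mxM.
  have [|||a [b [ra rb ->]]] := @eigenvalue_kron n1 n2 (map_mx iota A1) (map_mx iota A2)
      (vec_mx v) c.
  - by apply: contra v0 => /eqP e; rewrite -(vec_mxK v) e linear0.
  - move: vL; rewrite LE mulmxA !mul_rV_lin /= mxvecK => /(congr1 vec_mx).
    by rewrite mxvecK linearZ.
  - by move=> b; rewrite -map_char_poly c2 => /r2 /nz.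
  by apply: S12; [apply: r1; rewrite -c1 | apply: r2; rewrite -c2];
     rewrite map_char_poly.
rewrite BxyE -[u1^T *m u2]mxvecK -[F _]/(G _).
rewrite -(poly_act_morph (f := mulmxr L)) ?char_poly_act ?linear0 // => v.
change (F (vec_mx (v *m L)) = f3 (F (vec_mx v))).
by rewrite fF mulmxA !mul_rV_lin /= !mxvecK.
Qed.

End Torsion.

(** * Morphisms and zigzags *)

Lemma cls_eq0 (k : fieldType) (C : complex k) p (x : C p) : x \in @is_cycle k C p ->
  (cls x = 0) <-> (exists z, diff (p + 1) p z = x).
Proof.
by move=> cx; rewrite -(@cls0 k C p) cls_eq ?rpred0 // subr0.
Qed.

Lemma clsD (k : fieldType) (C : complex k) p (x y : C p) :
  x \in @is_cycle k C p -> y \in @is_cycle k C p -> cls (x + y) = cls x + cls y.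
Proof. by move=> cx cy; rewrite -[x in LHS]scale1r cls_linear // scale1r. Qed.

Lemma inj_bijective (A B : Type) (f : A -> B) :
  injective f -> (forall y, exists x, f x = y) -> bijective f.
Proof.
move=> inj surj; have /choice [g gK] := surj.
by exists g => // x; apply: inj; rewrite gK.
Qed.

Section Morphisms.
Variable k : fieldType.
Implicit Types P Q R : modop k.

Definition mid P : mhom P P.
Proof.
by refine (@Mhom k P P (fun g l p => idfun : {linear P g l p -> P g l p}) _ _ _ _).
Defined.

Definition mcomp P Q R (v : mhom Q R) (w : mhom P Q) : mhom P R.
Proof.
refine (@Mhom k P R (fun g l p => v g l p \o w g l p) _ _ _ _).
- by move=> *; rewrite /= !mhom_diff.
- by move=> *; rewrite /= !mhom_act.
- by move=> *; rewrite /= !mhom_comp.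
- by move=> *; rewrite /= !mhom_contr.
Defined.

Lemma mhom_inv P Q (w : mhom P Q) : (forall g l p, bijective (w g l p)) ->
  exists v : mhom Q P, forall g l p,
    cancel (w g l p) (v g l p) /\ cancel (v g l p) (w g l p).
Proof.
move=> bij; have surj g l p y : exists x, w g l p x == y.
  by have [v _ wK] := bij g l p; exists (v y); rewrite wK.
pose v g l p y := xchoose (surj g l p y).
have vK g l p : cancel (v g l p) (w g l p).
  by move=> y; apply/eqP; exact: (xchooseP (surj g l p y)).
have wK g l p : cancel (w g l p) (v g l p).
  by move=> x; apply: (bij_inj (bij g l p)); rewrite vK.
have v_lin g l p : linear (v g l p).
  by move=> a x y; apply: (bij_inj (bij g l p)); rewrite linearP !vK.
pose v' g l p := mk_linear (v_lin g l p).
have inj g l p := bij_inj (bij g l p).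
have v_diff g l p q a : v' g l q (diff p q a) = diff p q (v' g l p a).
  by apply: inj; rewrite mhom_diff !vK.
have v_act g l p s a : v' g l p (act s a) = act s (v' g l p a).
  by apply: inj; rewrite mhom_act !vK.
have v_comp g1 l1 p1 g2 l2 p2 g l p i a b : v' g l p (comp g l p i a b) =
    comp g l p i (v' g1 l1.+1 p1 a) (v' g2 l2.+1 p2 b).
  by apply: inj; rewrite mhom_comp !vK.
have v_contr g l p i j a : v' g.+1 l p (contr i j a) = contr i j (v' g l.+2 p a).
  by apply: inj; rewrite mhom_contr !vK.
by exists (Mhom v_diff v_act v_comp v_contr) => g l p; split; [exact: wK | exact: vK].
Qed.

Lemma weak_equivalence_intro P Q (w : mhom P Q) :
  (forall g l p (y : Q g l p), y \in @is_cycle k (Q g l) p ->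
     exists2 x, x \in @is_cycle k (P g l) p &
       exists u, diff (p + 1) p u = w g l p x - y) ->
  (forall g l p (x : P g l p) u, x \in @is_cycle k (P g l) p ->
     diff (p + 1) p u = w g l p x -> exists v, diff (p + 1) p v = x) ->
  weak_equivalence w.
Proof.
move=> surj inj g l p; apply: inj_bijective => [h1 h2 e|h].
  apply/eqP; rewrite -subr_eq0; apply/eqP.
  have {e} : homology_mhom w g l p (h1 - h2) = 0 by rewrite linearB e subrr.
  have [x cx ->] := clsP (h1 - h2).
  move=> e; have {e} : cls (w g l p x) = 0 by rewrite -e; exact/esym/homology_mappE.
  move=> /(cls_eq0 (mhom_cycle w cx)) [u /(inj _ _ _ _ _ cx) dv].
  exact/cls_eq0.
have [y cy ->] := clsP h; have [x cx [u du]] := surj _ _ _ _ cy.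
exists (cls x); rewrite [LHS]homology_mappE //; apply/cls_eq => //.
  exact: mhom_cycle.
by exists u.
Qed.

Lemma iso_weak_equivalence P Q (w : mhom P Q) :
  (forall g l p, bijective (w g l p)) -> weak_equivalence w.
Proof.
move=> /mhom_inv [v vK]; apply: weak_equivalence_intro => g l p.
  move=> y cy; exists (v g l p y); first exact: mhom_cycle.
  by exists 0; rewrite linear0 (vK g l p).2 subrr.
move=> x u cx du; exists (v g l (p + 1) u).
by rewrite -mhom_diff du (vK g l p).1.
Qed.

Lemma zigzag_trans P Q R : zigzag P Q -> zigzag Q R -> zigzag P R.
Proof.
move=> zPQ; elim=> {R} // [R S|R S] w _ zPR hw.
  exact: zigzag_forward zPR hw.
exact: zigzag_backward zPR hw.
Qed.

Lemma zigzag_sym P Q : zigzag P Q -> zigzag Q P.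
Proof.
elim=> {Q} [|Q R w _ zQP hw|Q R w _ zQP hw]; first exact: zigzag_refl.
  exact: zigzag_trans (zigzag_backward (zigzag_refl R) hw) zQP.
exact: zigzag_trans (zigzag_forward (zigzag_refl R) hw) zQP.
Qed.

(** [zigzag_homology] is a bare family of functions whose backward steps choose preimages. Preimages
    under a bijection being unique, these choices agree with the inverse morphism given by
    [mhom_inv]. *)
Lemma zigzag_homology_mhom P Q (z : zigzag P Q) :
  exists Z : mhom (homology_modop P) (homology_modop Q),
    (forall g l p x, Z g l p x = zigzag_homology z x) /\
    (forall g l p, bijective (Z g l p)).
Proof.
elim: z => {Q} [|Q R w z [Z [ZE Zbij]] hw|Q R w z [Z [ZE Zbij]] hw].
- by exists (mid _); split=> // g l p; exists id.
- exists (mcomp (homology_mhom w) Z); split=> [g l p x|g l p].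
    by rewrite /= ZE.
  exact: bij_comp (hw g l p) (Zbij g l p).
have [V VK] := mhom_inv hw.
exists (mcomp V Z); split=> [g l p x|g l p] /=.
  rewrite ZE; apply: (bij_inj (hw g l p)); rewrite (VK g l p).2.
  by apply/esym/eqP; exact: xchooseP (weak_equivalence_surj _ hw).
apply: bij_comp (Zbij g l p).
by exists (homology_mhom w g l p); [exact: (VK g l p).2 | exact: (VK g l p).1].
Qed.

Section ZeroDifferential.
Variable Q : modop k.
Hypothesis diff0 : forall g l p q (a : Q g l p), diff p q a = 0.

Lemma diff0_cycle g l p (a : Q g l p) : a \in @is_cycle k (Q g l) p.
Proof. by apply/is_cycleP => q; exact: diff0. Qed.

Lemma cls_diff0_linear g l p :
  linear (fun a : Q g l p => cls a : homology_modop Q g l p).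
Proof. by move=> a x y; apply: cls_linear; exact: diff0_cycle. Qed.

(** For Q = HP this identifies HP with H(HP), which is needed once HP itself serves as the model of
    P. *)
Definition cls_mhom : mhom Q (homology_modop Q).
Proof.
refine (@Mhom k Q (homology_modop Q)
  (fun g l p => mk_linear (@cls_diff0_linear g l p)) _ _ _ _) => /=.
- by move=> g l p q a; rewrite diff0 cls0.
- by move=> g l p s a; exact/esym/act_cls/diff0_cycle.
- by move=> g1 l1 p1 g2 l2 p2 g l p i a b; apply/esym/comp_cls; exact: diff0_cycle.
- by move=> g l p i j a; exact/esym/contr_cls/diff0_cycle.
Defined.

Lemma cls_mhom_bij g l p : bijective (cls_mhom g l p).
Proof.
apply: inj_bijective => [x y|h].
  move=> /(cls_eq (diff0_cycle x) (diff0_cycle y)) [z].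
  by rewrite diff0 => /esym/eqP; rewrite subr_eq0 => /eqP.
by have [a _ ->] := clsP h; exists a.
Qed.

End ZeroDifferential.

Lemma homology_diff0 P g l p q (a : homology_modop P g l p) : diff p q a = 0.
Proof. by []. Qed.

Lemma formal_weakly_equivalent P Q : weakly_equivalent P Q ->
  formal Q -> formal P.
Proof.
move=> [zPQ] [zQ]; have [Z [_ Zbij]] := zigzag_homology_mhom zPQ.
constructor; apply: zigzag_trans zPQ (zigzag_trans zQ _).
exact: zigzag_backward (zigzag_refl _) (iso_weak_equivalence Zbij).
Qed.

(** The model is HP. The zigzag may identify H(HP) with HP in a way other than the inverse of [cls],
    so psi is lifted to its conjugate by the automorphism [th] of HP that measures the
    difference. *)
Lemma formal_automorphisms_lift P : formal P ->
  exists (P' : modop k) (z : zigzag P' P),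
    forall psi : mhom (homology_modop P) (homology_modop P),
      is_aut psi -> exists2 f : mhom P' P', is_aut f & induces z f psi.
Proof.
move=> [/zigzag_sym z]; exists (homology_modop P), z => psi [psi' psiK].
have [Z [ZE Zbij]] := zigzag_homology_mhom z.
pose c := cls_mhom (@homology_diff0 P).
have cbij := cls_mhom_bij (@homology_diff0 P).
pose th := mcomp Z c.
have [|th' thK] := @mhom_inv _ _ th.
  by move=> g l p; exact: bij_comp (Zbij g l p) (cbij g l p).
exists (mcomp th' (mcomp psi th)).
  exists (mcomp th' (mcomp psi' th)) => g l p.
  have th'K := (thK g l p).2; have [K1 K2] := psiK g l p.
  by split=> x; rewrite /mcomp -/th; cbn -[th]; rewrite th'K ?K1 ?K2 (thK g l p).1.
move=> g l p x; rewrite -!ZE.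
have [c' _ cK] := cbij g l p.
rewrite -(cK x); set y := c' x.
rewrite -[Z g l p (c g l p y)]/(th g l p y).
rewrite [homology_mhom _ g l p _](_ : _ = c g l p (mcomp th' (mcomp psi th) g l p y)).
  by rewrite -[Z g l p _]/(th g l p (th' g l p (psi g l p (th g l p y)))) (thK g l p).2.
exact: homology_mappE (diff0_cycle (@homology_diff0 P) y).
Qed.

End Morphisms.

(** * Suboperads *)

(** Membership is a [Prop] because the conditions in use, on paths and on truncations, are
    existential; [asbool] then yields the predicate behind the subtype. *)
Record subspace (k : fieldType) (V : lmodType k) := Subspace {
  in_subspace :> V -> Prop;
  subspace0 : in_subspace 0;
  subspace_linear : forall a x y,
    in_subspace x -> in_subspace y -> in_subspace (a *: x + y)
}.

Section Submodule.
Variables (k : fieldType) (V : lmodType k) (S : subspace V).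

Definition subspace_pred : {pred V} := fun x => `[< S x >].

Lemma subspace_pred_closed : submod_closed subspace_pred.
Proof.
split=> [|a x y]; rewrite !unfold_in; first exact/asboolP/subspace0.
by move=> /asboolP Sx /asboolP Sy; apply/asboolP/subspace_linear.
Qed.
HB.instance Definition _ :=
  GRing.isSubmodClosed.Build k V subspace_pred subspace_pred_closed.

Record submodule := Submodule {
  submodule_val : V;
  submodule_pred : submodule_val \in subspace_pred
}.
HB.instance Definition _ := [isSub for submodule_val].
HB.instance Definition _ := [Choice of submodule by <:].
HB.instance Definition _ := [SubChoice_isSubLmodule of submodule by <:].

Definition in_sub x (Sx : S x) : submodule := Submodule (introT (asboolP (S x)) Sx).

Lemma submodule_valP (x : submodule) : S (val x).
Proof. exact: (elimT (asboolP _) (submodule_pred x)). Qed.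

End Submodule.

Section Restriction.
Variables (k : fieldType) (V W : lmodType k) (S : subspace V) (S' : subspace W).
Variables (f : {linear V -> W}) (fS : forall x, S x -> S' (f x)).

Lemma restriction_linear :
  linear (fun x : submodule S => in_sub (fS (submodule_valP x))).
Proof. by move=> a x y; apply: val_inj; rewrite /= !linearP. Qed.

Definition restriction : {linear submodule S -> submodule S'} :=
  mk_linear restriction_linear.

End Restriction.

Section SubOperad.
Variables (k : fieldType) (P : modop k).
Variable S : forall g l p, subspace (P g l p).
Hypothesis S_diff : forall g l p q x, S g l p x -> S g l q (diff p q x).
Hypothesis S_act : forall g l p (s : 'S_l) x, S g l p x -> S g l p (act s x).
Hypothesis S_comp : forall g1 l1 p1 g2 l2 p2 g l p (i : 'I_l1.+1) x y,
  S g1 l1.+1 p1 x -> S g2 l2.+1 p2 y -> S g l p (comp g l p i x y).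
Hypothesis S_contr : forall g l p (i j : 'I_l.+2) x,
  S g l.+2 p x -> S g.+1 l p (contr i j x).

Definition sub_diff g l p q := restriction (@S_diff g l p q).

Lemma sub_diff_dead g l p q x : p != q + 1 -> sub_diff g l p q x = 0.
Proof. by move=> ne; apply: val_inj; exact: diff_dead. Qed.

Lemma sub_diffK g l p q r x : sub_diff g l q r (sub_diff g l p q x) = 0.
Proof. by apply: val_inj; exact: diffK. Qed.

Definition sub_complex g l : complex k :=
  Complex (@sub_diff_dead g l) (@sub_diffK g l).

Definition sub_act g l p s := restriction (@S_act g l p s).

Definition sub_contr g l p i j := restriction (@S_contr g l p i j).

Definition sub_comp g1 l1 p1 g2 l2 p2 g l p (i : 'I_l1.+1)
    (x : sub_complex g1 l1.+1 p1) (y : sub_complex g2 l2.+1 p2) :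
    sub_complex g l p :=
  in_sub (S_comp g l p i (submodule_valP x) (submodule_valP y)).

Definition sub_complex_val g l p : {linear sub_complex g l p -> P g l p} :=
  \val : {linear submodule (S g l p) -> P g l p}.

Lemma sub_complex_inj g l p (x y : sub_complex g l p) :
  sub_complex_val g l p x = sub_complex_val g l p y -> x = y.
Proof. exact: val_inj. Qed.

Definition suboperad : modop k.
Proof.
refine (@Modop k sub_complex _ sub_act sub_comp sub_contr
          _ _ _ _ _ _ _ _ _ _ _ _ _ _ _ _ _ _).
- by move=> g l p a st; refine (sub_complex_inj _); exact: car_unstable.
- by move=> *; refine (sub_complex_inj _); exact: act1.
- by move=> *; refine (sub_complex_inj _); exact: actM.
- by move=> *; refine (sub_complex_inj _); exact: act_diff.
- by move=> *; refine (sub_complex_inj _); exact: comp_dead.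
- move=> g1 l1 p1 g2 l2 p2 g l p i b a x y; refine (sub_complex_inj _);
  exact: comp_linear_l.
- move=> g1 l1 p1 g2 l2 p2 g l p i b a x y; refine (sub_complex_inj _);
  exact: comp_linear_r.
- by move=> *; refine (sub_complex_inj _); exact: comp_diff.
- by move=> *; refine (sub_complex_inj _); exact: contr_dead.
- by move=> *; refine (sub_complex_inj _); exact: contr_diff.
- by move=> *; refine (sub_complex_inj _); exact: comp_act.
- by move=> *; refine (sub_complex_inj _); exact: comp_comm.
- by move=> *; refine (sub_complex_inj _); apply: comp_assoc; eassumption.
- by move=> *; refine (sub_complex_inj _); apply: comp_par; eassumption.
- by move=> *; refine (sub_complex_inj _); exact: contr_sym.
- by move=> *; refine (sub_complex_inj _); apply: contr_act.
- by move=> *; refine (sub_complex_inj _); apply: contr_comm.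
- by move=> *; refine (sub_complex_inj _); apply: contr_comp.
- by move=> *; refine (sub_complex_inj _); apply: contr_comp_swap; eassumption.
Defined.

Definition suboperad_val : mhom suboperad P.
Proof.
by refine (@Mhom k suboperad P (fun g l p => sub_complex_val g l p) _ _ _ _).
Defined.

End SubOperad.

(** * Path objects *)

Section Jets.
Variables (k : fieldType).

Lemma sgnD (p q : int) : (-1) ^ (p + q) = (-1) ^ p * (-1) ^ q :> k.
Proof. by rewrite expfzDr ?oppr_eq0 ?oner_eq0. Qed.

Lemma sgnS (p : int) : (-1) ^ (p + 1) = - (-1) ^ p :> k.
Proof. by rewrite sgnD expr1z mulrN1. Qed.

Lemma sgnM (p q : int) : (-1) ^ (p * (q + 1)) = (-1) ^ (p * q) * (-1) ^ p :> k.
Proof. by rewrite mulrDr mulr1 sgnD. Qed.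

Lemma sgnMl (p q : int) : (-1) ^ ((p + 1) * q) = (-1) ^ (p * q) * (-1) ^ q :> k.
Proof. by rewrite mulrDl mul1r sgnD. Qed.

Lemma sgnK (p : int) : (-1) ^ p * (-1) ^ p = 1 :> k.
Proof. by rewrite -expfzMl mulrNN mulr1 exp1rz. Qed.

Lemma gluesSl g1 l1 p1 g2 l2 p2 g l p :
  glues g1 l1 (p1 + 1) g2 l2 p2 g l (p + 1) = glues g1 l1 p1 g2 l2 p2 g l p.
Proof. by rewrite /glues addrAC (inj_eq (addIr _)). Qed.

Lemma gluesSr g1 l1 p1 g2 l2 p2 g l p :
  glues g1 l1 p1 g2 l2 (p2 + 1) g l (p + 1) = glues g1 l1 p1 g2 l2 p2 g l p.
Proof. by rewrite /glues addrA (inj_eq (addIr _)). Qed.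

Section Cast.
Variable C : complex k.

(** An identity map with arbitrary source and target degrees, zero unless they match, in the same
    style as [diff]. It is the part of the differential of a path that turns a derivative into a
    coefficient of ds. *)
Definition degree_cast (i j : int) : {linear C i -> C j} :=
  if i =P j is ReflectT e
  then ecast m {linear C i -> C m} e (idfun : {linear C i -> C i}) else \0.

Lemma degree_cast_id i x : degree_cast i i x = x.
Proof. by rewrite /degree_cast; case: eqP => // e; rewrite eq_axiomK. Qed.

Lemma degree_cast_neq i j x : i != j -> degree_cast i j x = 0.
Proof. by rewrite /degree_cast; case: eqP. Qed.

End Cast.

Lemma triple_ext (A B D : Type) (x y : A * B * D) :
  x.1.1 = y.1.1 -> x.1.2 = y.1.2 -> x.2 = y.2 -> x = y.
Proof. by case: x y => [[? ?] ?] [[? ?] ?] /= -> -> ->. Qed.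

Section Triples.
Variables U W : lmodType k.

Lemma triple_map_linear (U' W' : lmodType k) (f : {linear U -> U'})
    (h : {linear W -> W'}) :
  linear (fun x : (U * U * W)%type => (f x.1.1, f x.1.2, h x.2)).
Proof. by move=> a x y; apply: triple_ext; rewrite /= linearP. Qed.

Definition triple_map (U' W' : lmodType k) (f : {linear U -> U'})
    (h : {linear W -> W'}) : {linear (U * U * W)%type -> (U' * U' * W')%type} :=
  mk_linear (triple_map_linear f h).

End Triples.

End Jets.

Section JetOperad.
Variables (k : fieldType) (P : modop k).

Lemma compDl g1 l1 p1 g2 l2 p2 g l p i (a a' : P g1 l1.+1 p1)
    (b : P g2 l2.+1 p2) :
  comp g l p i (a + a') b = comp g l p i a b + comp g l p i a' b.
Proof. exact: linearD (mk_linear (comp_linear_l g l p i b)) _ _. Qed.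

Lemma compDr g1 l1 p1 g2 l2 p2 g l p i (a : P g1 l1.+1 p1)
    (b b' : P g2 l2.+1 p2) :
  comp g l p i a (b + b') = comp g l p i a b + comp g l p i a b'.
Proof. exact: linearD (mk_linear (comp_linear_r g l p i a)) _ _. Qed.

Section Complex.
Variable (C : complex k).

(** For a' of degree p and d delta = eps, the Koszul rule gives d(a' delta) = (d a') delta + (-1)^p
    a' eps. As eps has degree -1, its coefficient sits one degree higher. *)
Lemma jet_diff_linear p q :
  linear (fun x : (C p * C p * C (p + 1)%R)%type =>
    (diff p q x.1.1, diff p q x.1.2,
     (-1) ^ p *: degree_cast C p (q + 1) x.1.2 + diff (p + 1) (q + 1) x.2)).
Proof.
move=> a x y; apply: triple_ext; rewrite /= !linearP //=.
by rewrite !scalerA (mulrC a) addrACA.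
Qed.

Definition jet_diff p q : {linear _ -> _} := mk_linear (@jet_diff_linear p q).

Lemma jet_diff_dead p q x : p != q + 1 -> jet_diff p q x = 0.
Proof.
move=> ne; apply: triple_ext; rewrite /= ?diff_dead ?(inj_eq (addIr _)) //.
by rewrite degree_cast_neq // scaler0 addr0.
Qed.

Lemma jet_diffK p q r x : jet_diff q r (jet_diff p q x) = 0.
Proof.
apply: triple_ext; rewrite /= ?diffK // linearD linearZ /= diffK addr0.
have [e|ne] := eqVneq p (q + 1); last first.
  by rewrite (degree_cast_neq _ ne) (diff_dead _ ne) !linear0 addr0.
subst p; rewrite degree_cast_id; have [e|ne] := eqVneq q (r + 1); last first.
  rewrite (degree_cast_neq _ ne) diff_dead ?(inj_eq (addIr _)) //.
  by rewrite !scaler0 addr0.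
by subst q; rewrite degree_cast_id !sgnS !scaleNr opprK addNr.
Qed.

Definition jet_complex : complex k := Complex jet_diff_dead jet_diffK.

End Complex.

Let jet g l := jet_complex (P g l).

Definition jet_act g l p (s : 'S_l) : {linear jet g l p -> jet g l p} :=
  triple_map (act s) (act s).

Definition jet_contr g l p (i j : 'I_l.+2) :
    {linear jet g l.+2 p -> jet g.+1 l p} :=
  triple_map (contr i j) (contr i j).

(** The sign moves eps past the second factor, of degree [p2]; products of two elements among delta
    and eps vanish. *)
Definition jet_comp g1 l1 p1 g2 l2 p2 g l p (i : 'I_l1.+1)
    (x : jet g1 l1.+1 p1) (y : jet g2 l2.+1 p2) : jet g l p :=
  (comp g l p i x.1.1 y.1.1,
   comp g l p i x.1.2 y.1.1 + comp g l p i x.1.1 y.1.2,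
   comp g l (p + 1) i x.1.1 y.2 + (-1) ^ p2 *: comp g l (p + 1) i x.2 y.1.1).

Lemma jet_ext g l p (x y : jet g l p) :
  x.1.1 = y.1.1 -> x.1.2 = y.1.2 -> x.2 = y.2 -> x = y.
Proof. exact: triple_ext. Qed.

(* The tensor product with the commutative algebra k[delta, eps] / (delta, eps)^2
   with d delta = eps; delta has degree 0 and eps has degree -1.  A triple
   (a, a', b) stands for a + a' delta + b eps. *)
Definition jet_modop : modop k.
Proof.
refine (@Modop k jet _ jet_act jet_comp jet_contr
          _ _ _ _ _ _ _ _ _ _ _ _ _ _ _ _ _ _).
- move=> g l p x st; refine (jet_ext _ _ _); rewrite /= ?[LHS]car_unstable //.
- by move=> g l p x; refine (jet_ext _ _ _); exact: act1.
- by move=> g l p s t x; refine (jet_ext _ _ _); exact: actM.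
- move=> g l p q s x; refine (jet_ext _ _ _); rewrite /= ?act_diff //.
  rewrite linearD linearZ /= -act_diff; congr (_ *: _ + _).
  have [e|ne] := eqVneq p (q + 1); first by subst p; rewrite !degree_cast_id.
  by rewrite !degree_cast_neq // linear0.
- move=> g1 l1 p1 g2 l2 p2 g l p i x y gl.
  by refine (jet_ext _ _ _); rewrite /= !comp_dead ?gluesSl ?gluesSr ?scaler0 ?addr0.
- move=> g1 l1 p1 g2 l2 p2 g l p i y a x x'.
  refine (jet_ext _ _ _); rewrite /= !compDl !compZl //.
    by rewrite scalerDr addrACA.
  by rewrite !scalerDr !scalerA (mulrC a) addrACA.
- move=> g1 l1 p1 g2 l2 p2 g l p i x a y y'.
  refine (jet_ext _ _ _); rewrite /= !compDr !compZr //.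
    by rewrite scalerDr addrACA.
  by rewrite !scalerDr !scalerA (mulrC a) addrACA.
- move=> g1 l1 p1 q1 g2 l2 p2 q2 g l p q i x y gl e1 e2 e.
  move: x y gl; rewrite {}e1 {}e2 {}e => x y gl.
  refine (jet_ext _ _ _); rewrite /=.
  + exact: comp_diff gl _ _ _.
  + rewrite linearD !(comp_diff _ _ _ gl (erefl _) (erefl _) (erefl _)).
    by rewrite scalerDr addrACA.
  have gll := gl; rewrite -gluesSl in gll; have glr := gl; rewrite -gluesSr in glr.
  rewrite !degree_cast_id !linearD linearZ /=.
  rewrite (comp_diff _ _ _ glr (erefl _) (erefl _) (erefl _)).
  rewrite (comp_diff _ _ _ gll (erefl _) (erefl _) (erefl _)).
  rewrite !compDl !compDr !compZl !compZr !scalerDr !scalerA.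
  have -> : (-1) ^ (q + 1) = (-1) ^ (q1 + 1) * (-1) ^ (q2 + 1) :> k.
    by move: gl => /and3P [_ _ /eqP ->]; rewrite sgnD.
  rewrite (sgnS k (q1 + 1)) -[(-1) ^ q2]opprK -(sgnS k q2).
  rewrite !mulrN (mulrC ((-1) ^ (q2 + 1))).
  by rewrite [LHS](AC (2 * (2 * 2)) ((3 * (1 * 5)) * ((2 * 4) * 6))).
- by move=> g l p i x; refine (jet_ext _ _ _); exact: contr_dead.
- move=> g l p q i j x; refine (jet_ext _ _ _); rewrite /= ?contr_diff //.
  rewrite linearD linearZ /= -contr_diff; congr (_ *: _ + _).
  have [e|ne] := eqVneq p (q + 1); first by subst p; rewrite !degree_cast_id.
  by rewrite !degree_cast_neq // linear0.
- move=> g1 l1 p1 g2 l2 p2 g l p i s t r x y gl t0 rl rr.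
  have gll := gl; rewrite -gluesSl in gll; have glr := gl; rewrite -gluesSr in glr.
  refine (jet_ext _ _ _); rewrite /=.
  + exact: comp_act gl t0 rl rr.
  + by rewrite linearD /= !(comp_act _ _ gl t0 rl rr).
  by rewrite linearD linearZ /= (comp_act _ _ gll t0 rl rr) (comp_act _ _ glr t0 rl rr).
- move=> g1 l1 p1 g2 l2 p2 g l p i s r x y gl s0 rl rr.
  have gll := gl; rewrite -gluesSl in gll; have glr := gl; rewrite -gluesSr in glr.
  refine (jet_ext _ _ _); rewrite /=.
  + exact: comp_comm gl s0 rl rr.
  + by rewrite linearD /= !(comp_comm _ _ gl s0 rl rr) scalerDr addrC.
  rewrite linearD linearZ /= (comp_comm _ _ gll s0 rl rr) (comp_comm _ _ glr s0 rl rr).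
  rewrite sgnM sgnMl scalerDr !scalerA [X in _ + X *: _]mulrCA sgnK mulr1.
  exact: addrC.
- move=> g1 l1 p1 g2 l2 p2 g3 l3 p3 g12 l12 p12 g23 l23 p23 g l p i j m x y z.
  move=> gl gl' gl'' j0 mE.
  have := gl; rewrite -gluesSl => gll; have := gl; rewrite -gluesSr => glr.
  have := gl'; rewrite -gluesSl => gll'; have := gl'; rewrite -gluesSr => glr'.
  have := gl''; rewrite -gluesSl => gll''; have := gl''; rewrite -gluesSr => glr''.
  refine (jet_ext _ _ _); rewrite /=.
  + exact: comp_assoc gl gl' gl'' j0 mE.
  + by rewrite !(compDl, compDr) !(comp_assoc _ _ _ gl gl' gl'' j0 mE) addrA.
  rewrite !(compDl, compDr) !(compZl, compZr) !scalerDr.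
  rewrite (comp_assoc _ _ _ gl glr' glr'' j0 mE).
  rewrite (comp_assoc _ _ _ glr gll' gll'' j0 mE).
  rewrite (comp_assoc _ _ _ gll gl' gll'' j0 mE) addrA scalerA -sgnD addrC.
  have -> : p23 = p3 + p2 by have /and3P [_ _ /eqP ->] := gl'; exact: addrC.
  exact: addrC.
- move=> g1 l1 p1 g2 l2 p2 g3 l3 p3 g12 l12 p12 g13 l13 p13 g l p i j m n x y z.
  move=> gl gl' gl'' ij mE nE.
  have := gl; rewrite -gluesSl => gll; have := gl; rewrite -gluesSr => glr.
  have := gl'; rewrite -gluesSl => gll'; have := gl'; rewrite -gluesSr => glr'.
  have := gl''; rewrite -gluesSl => gll''; have := gl''; rewrite -gluesSr => glr''.
  refine (jet_ext _ _ _); rewrite /=.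
  + exact: comp_par gl gl' gl'' ij mE nE.
  + rewrite !(compDl, compDr) !(comp_par _ _ _ gl gl' gl'' ij mE nE) scalerDr.
    by rewrite scalerDr addrAC.
  rewrite !(compDl, compDr) !(compZl, compZr) !scalerDr.
  rewrite (comp_par _ _ _ gl glr' glr'' ij mE nE).
  rewrite (comp_par _ _ _ glr gl' gll'' ij mE nE).
  rewrite (comp_par _ _ _ gll gll' gll'' ij mE nE).
  rewrite sgnM sgnMl !scalerA [_ ^ p3 * (_ * _)]mulrCA sgnK mulr1 [LHS]addrCA.
  by congr (_ + (_ + _ *: _)); rewrite mulrC [X in _ * X]mulrC mulrA.
- by move=> g l p i j x; refine (jet_ext _ _ _); exact: contr_sym.
- by move=> g l p i j s r x ij rE; refine (jet_ext _ _ _); exact: contr_act.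
- by move=> g l p i j m n i' j' m' n' x u mE nE iE jE;
     refine (jet_ext _ _ _); exact: contr_comm.
- move=> g1 l1 p1 g2 l2 p2 g l p i x y i' m n a b gl u mE nE iE.
  have := gl; rewrite -gluesSl => gll; have := gl; rewrite -gluesSr => glr.
  refine (jet_ext _ _ _); rewrite /=.
  + exact: contr_comp gl u mE nE iE.
  + by rewrite linearD /= !(contr_comp _ _ gl u mE nE iE).
  rewrite linearD linearZ /= (contr_comp _ _ gll u mE nE iE).
  by rewrite (contr_comp _ _ glr u mE nE iE).
- move=> g1 l1 p1 g2 l2 p2 g l p i x y t m n m' n' r a b.
  move=> gl ix y0 ty mE nE mE' nE' ru rv.
  have := gl; rewrite -gluesSl => gll; have := gl; rewrite -gluesSr => glr.
  refine (jet_ext _ _ _); rewrite /=.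
  + exact: contr_comp_swap gl ix y0 ty mE nE mE' nE' ru rv.
  + by rewrite !linearD /= !(contr_comp_swap _ _ gl ix y0 ty mE nE mE' nE' ru rv).
  rewrite !linearD !linearZ /= (contr_comp_swap _ _ gll ix y0 ty mE nE mE' nE' ru rv).
  by rewrite (contr_comp_swap _ _ glr ix y0 ty mE nE mE' nE' ru rv).
Defined.
End JetOperad.

(** * Pointwise operads of functions *)

Section FunctionOperad.
Variables (k : fieldType) (X : Type) (P : modop k).

Lemma pointwise_linear (U V : lmodType k) (f : {linear U -> V}) :
  linear (fun (y : X -> U) x => f (y x)).
Proof. by move=> a y z; apply/funext => x; rewrite /= linearP. Qed.

Definition pointwise (U V : lmodType k) (f : {linear U -> V}) :
    {linear (X -> U) -> (X -> V)} := mk_linear (pointwise_linear f).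

Definition fun_diff g l p q : {linear (X -> P g l p) -> (X -> P g l q)} :=
  pointwise (diff p q).

Lemma fun_diff_dead g l p q y : p != q + 1 -> fun_diff g l p q y = 0.
Proof. by move=> ne; apply/funext => x; exact: diff_dead. Qed.

Lemma fun_diffK g l p q r y : fun_diff g l q r (fun_diff g l p q y) = 0.
Proof. by apply/funext => x; exact: diffK. Qed.

Definition fun_complex g l : complex k :=
  Complex (@fun_diff_dead g l) (@fun_diffK g l).

Definition fun_act g l p (s : 'S_l) :
    {linear fun_complex g l p -> fun_complex g l p} := pointwise (act s).

Definition fun_contr g l p (i j : 'I_l.+2) :
    {linear fun_complex g l.+2 p -> fun_complex g.+1 l p} :=
  pointwise (contr i j).

Definition fun_comp g1 l1 p1 g2 l2 p2 g l p (i : 'I_l1.+1)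
    (y : fun_complex g1 l1.+1 p1) (z : fun_complex g2 l2.+1 p2) :
    fun_complex g l p := fun x => comp g l p i (y x) (z x).

Lemma fun_ext g l p (y z : fun_complex g l p) : (forall x, y x = z x) -> y = z.
Proof. by move=> e; apply/funext. Qed.

Definition fun_modop : modop k.
Proof.
refine (@Modop k fun_complex _ fun_act fun_comp fun_contr
          _ _ _ _ _ _ _ _ _ _ _ _ _ _ _ _ _ _).
- by move=> g l p y st; refine (fun_ext _) => x; exact: car_unstable.
- by move=> *; refine (fun_ext _) => x; exact: act1.
- by move=> *; refine (fun_ext _) => x; exact: actM.
- by move=> *; refine (fun_ext _) => x; exact: act_diff.
- by move=> *; refine (fun_ext _) => x; exact: comp_dead.
- by move=> g1 l1 p1 g2 l2 p2 g l p i b a y z; refine (fun_ext _) => x;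
     exact: comp_linear_l.
- by move=> g1 l1 p1 g2 l2 p2 g l p i b a y z; refine (fun_ext _) => x;
     exact: comp_linear_r.
- by move=> *; refine (fun_ext _) => x; exact: comp_diff.
- by move=> *; refine (fun_ext _) => x; exact: contr_dead.
- by move=> *; refine (fun_ext _) => x; exact: contr_diff.
- by move=> *; refine (fun_ext _) => x; exact: comp_act.
- by move=> *; refine (fun_ext _) => x; exact: comp_comm.
- by move=> *; refine (fun_ext _) => x; apply: comp_assoc; eassumption.
- by move=> *; refine (fun_ext _) => x; apply: comp_par; eassumption.
- by move=> *; refine (fun_ext _) => x; exact: contr_sym.
- by move=> *; refine (fun_ext _) => x; apply: contr_act.
- by move=> *; refine (fun_ext _) => x; apply: contr_comm.
- by move=> *; refine (fun_ext _) => x; apply: contr_comp.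
- by move=> *; refine (fun_ext _) => x; apply: contr_comp_swap; eassumption.
Defined.

End FunctionOperad.

(** * Vector-valued polynomial functions and their derivatives *)

Section PolynomialFunctions.
Variable k : fieldType.

(** The witness r is an element of k[s] tensored with V, and f' is the derivative read off from it.
    Keeping functions, and not V-valued polynomials, as the data allows paths to sit in a pointwise
    operad. *)
Definition jet_of (V : lmodType k) (f f' : k -> V) : Prop :=
  exists r : seq ({poly k} * V),
    (forall s, f s = \sum_(x <- r) x.1.[s] *: x.2) /\
    (forall s, f' s = \sum_(x <- r) x.1^`().[s] *: x.2).

Definition polynomial (V : lmodType k) (f : k -> V) : Prop :=
  exists f', jet_of f f'.

Lemma jet_of_ext (V : lmodType k) (f f' h h' : k -> V) :
  f =1 h -> f' =1 h' -> jet_of f f' -> jet_of h h'.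
Proof.
by move=> e e' [r [rE rE']]; exists r; split=> s; rewrite -(e, e').
Qed.

Lemma jet_of_monomial (V : lmodType k) (q : {poly k}) (v : V) :
  jet_of (fun s => q.[s] *: v) (fun s => q^`().[s] *: v).
Proof. by exists [:: (q, v)]; split=> s; rewrite big_seq1. Qed.

Lemma jet_of_cst (V : lmodType k) (v : V) : jet_of (fun=> v) (fun=> 0).
Proof.
apply: jet_of_ext (jet_of_monomial 1%:P v) => s.
  by rewrite hornerC scale1r.
by rewrite derivC horner0 scale0r.
Qed.

Lemma jet_ofP (V : lmodType k) (f f' h h' : k -> V) a :
  jet_of f f' -> jet_of h h' ->
  jet_of (fun s => a *: f s + h s) (fun s => a *: f' s + h' s).
Proof.
move=> [r [rE rE']] [t [tE tE']].
exists ([seq (x.1, a *: x.2) | x <- r] ++ t); split=> s.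
  rewrite big_cat big_map rE tE scaler_sumr; congr (_ + _).
  by apply: eq_bigr => x _; rewrite /= !scalerA mulrC.
rewrite big_cat big_map rE' tE' scaler_sumr; congr (_ + _).
by apply: eq_bigr => x _; rewrite /= !scalerA mulrC.
Qed.

Lemma jet_of_linear (V W : lmodType k) (u : {linear V -> W}) (f f' : k -> V) :
  jet_of f f' -> jet_of (fun s => u (f s)) (fun s => u (f' s)).
Proof.
move=> [r [rE rE']]; exists [seq (x.1, u x.2) | x <- r].
by split=> s; rewrite big_map (rE, rE') linear_sum; apply: eq_bigr => x _;
   rewrite linearZ.
Qed.

Lemma jet_of_bilinear (U V W : lmodType k) (B : U -> V -> W)
    (f f' : k -> U) (h h' : k -> V) :
  (forall v, linear (B^~ v)) -> (forall u, linear (B u)) ->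
  jet_of f f' -> jet_of h h' ->
  jet_of (fun s => B (f s) (h s)) (fun s => B (f' s) (h s) + B (f s) (h' s)).
Proof.
move=> Bl Br [r [rE rE']] [t [tE tE']].
pose Bl' v := mk_linear (Bl v); pose Br' u := mk_linear (Br u).
have Bsum (p : {poly k} * U -> k) (p' : {poly k} * V -> k) :
    B (\sum_(x <- r) p x *: x.2) (\sum_(y <- t) p' y *: y.2) =
    \sum_(x <- r) \sum_(y <- t) (p x * p' y) *: B x.2 y.2.
  transitivity (\sum_(x <- r) B (p x *: x.2) (\sum_(y <- t) p' y *: y.2)).
    exact: (linear_sum (Bl' _)).
  apply: eq_bigr => x _.
  transitivity (\sum_(y <- t) B (p x *: x.2) (p' y *: y.2)).
    exact: (linear_sum (Br' _)).
  apply: eq_bigr => y _.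
  transitivity (p x *: B x.2 (p' y *: y.2)); first exact: (linearZZ (Bl' _)).
  by rewrite -scalerA; congr (_ *: _); exact: (linearZZ (Br' _)).
exists [seq (x.1 * y.1, B x.2 y.2) | x <- r, y <- t]; split=> s.
  rewrite rE tE Bsum // big_allpairs_dep /=.
  by do 2![apply: eq_bigr => ? _]; rewrite hornerM.
rewrite rE tE rE' tE' !Bsum // -big_split big_allpairs_dep /=.
apply: eq_bigr => x _; rewrite -big_split; apply: eq_bigr => y _.
by rewrite derivM hornerD !hornerM scalerDl.
Qed.

Lemma polynomial_deriv (V : lmodType k) (f f' : k -> V) :
  jet_of f f' -> polynomial f'.
Proof.
move=> [r [_ rE']]; eexists; exists [seq (x.1^`(), x.2) | x <- r].
split=> s; last by [].
by rewrite big_map rE'.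
Qed.

Hypothesis char_k : [pchar k] =i pred0.

Lemma natr_neq0 n : n.+1%:R != 0 :> k.
Proof. by rewrite (pcharf0P k).1. Qed.

(** Evaluate at 0, ..., n - 1, which are distinct in characteristic zero, and apply the inverse
    Vandermonde matrix to the resulting vectors. *)
Lemma vanishing_coefs (V : lmodType k) n (c : 'I_n -> V) :
  (forall s : k, \sum_(i < n) s ^+ i *: c i = 0) -> forall i, c i = 0.
Proof.
move=> c0 i; pose a : 'rV[k]_n := \row_j (j : nat)%:R.
have Vu : Vandermonde n a \in unitmx.
  rewrite unitmxE unitfE det_Vandermonde prodf_seq_neq0; apply/allP => x _.
  apply/implyP => _; rewrite prodf_seq_neq0; apply/allP => y _; apply/implyP => lt.
  rewrite !mxE -natrB ?(ltnW lt) //; move: lt; rewrite -subn_gt0.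
  by case: (_ - _)%N => // m _; exact: natr_neq0.
transitivity (\sum_j invmx (Vandermonde n a) j i *: \sum_(m < n) a 0 j ^+ m *: c m);
    last by apply: big1 => j _; rewrite c0 scaler0.
transitivity (\sum_m (Vandermonde n a *m invmx (Vandermonde n a)) m i *: c m).
  rewrite mulmxV // (bigD1 i) //= mxE eqxx scale1r big1 ?addr0 // => j ne.
  by rewrite mxE (negPf ne) scale0r.
under eq_bigr do rewrite mxE scaler_suml.
rewrite exchange_big; apply: eq_bigr => j _; rewrite scaler_sumr.
by apply: eq_bigr => m _; rewrite scalerA [in RHS]mulrC [Vandermonde _ _ _ _]mxE.
Qed.

(** The witness is not unique, so both functions are first expanded in powers of s. The derivative
    has coefficients (i + 1) c_(i+1), and their vanishing leaves only c_0 in f. *)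
Lemma jet_of_deriv0 (V : lmodType k) (f : k -> V) :
  jet_of f (fun=> 0) -> forall s, f s = f 0.
Proof.
move=> [r [rE rE']] s.
pose n := \max_(x <- r) size x.1; pose c i := \sum_(x <- r) x.1`_i *: x.2.
have le_n x : x \in r -> (size x.1 <= n)%N.
  by move=> xr; rewrite /n; exact: leq_bigmax_seq.
have fE t : f t = \sum_(i < n) t ^+ i *: c i.
  rewrite rE /c; under [RHS]eq_bigr do rewrite scaler_sumr.
  rewrite exchange_big /=; apply: eq_big_seq => x xr.
  rewrite (horner_coef_wide _ (le_n x xr)) scaler_suml; apply: eq_bigr => i _.
  by rewrite scalerA mulrC.
have f'E t : \sum_(i < n) t ^+ i *: (i.+1%:R *: c i.+1) = 0.
  rewrite [RHS](rE' t) /c; under eq_bigr do rewrite scalerA scaler_sumr.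
  rewrite exchange_big /=; apply: eq_big_seq => x xr.
  have le_n' : (size x.1^`() <= n)%N.
    exact: leq_trans (size_poly _ _) (leq_trans (leq_pred _) (le_n x xr)).
  rewrite (horner_coef_wide _ le_n') scaler_suml; apply: eq_bigr => i _.
  by rewrite !scalerA coef_deriv -[x.1`_i.+1 *+ _]mulr_natl -mulrA mulrC.
have c0 i : (i < n)%N -> c i.+1 = 0.
  move=> lt; have := vanishing_coefs f'E (Ordinal lt) => /eqP /=.
  by rewrite scaler_eq0 (negPf (natr_neq0 _)) => /eqP.
rewrite !fE; apply: eq_bigr => -[[|i] lt] _ /=; first by rewrite !expr0.
by rewrite c0 ?scaler0 // ltnW.
Qed.

(** The constant term is a division by 0, hence 0 by convention, which normalizes the primitive to
    vanish at 0. *)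
Definition primitive (q : {poly k}) : {poly k} :=
  \poly_(i < (size q).+1) (q`_i.-1 / i%:R).

Lemma deriv_primitive q : (primitive q)^`() = q.
Proof.
apply/polyP => i; rewrite coef_deriv coef_poly ltnS.
case: ltnP => [_|le]; last by rewrite mul0rn nth_default.
by rewrite -[LHS]mulr_natr divfK ?natr_neq0.
Qed.

Lemma primitive0 q : (primitive q).[0] = 0.
Proof. by rewrite horner_coef0 coef_poly /= invr0 mulr0. Qed.

Lemma polynomial_primitive (V : lmodType k) (f : k -> V) :
  polynomial f -> exists F, jet_of F f /\ F 0 = 0.
Proof.
move=> [_ [r [rE _]]].
exists (fun s => \sum_(x <- r) (primitive x.1).[s] *: x.2); split.
  exists [seq (primitive x.1, x.2) | x <- r].
  split=> s; rewrite big_map // rE; apply: eq_bigr => x _.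
  by rewrite deriv_primitive.
by apply: big1 => x _; rewrite primitive0 scale0r.
Qed.

End PolynomialFunctions.

(** * The operad of sequences of paths *)

Section PathOperad.
Variables (k : fieldType) (P : modop k) (f : mhom P P).

(** The algebra map s -> s_0 + delta, ds -> eps sends a form in k[s, ds] to its jet at s_0.
    Recording the jets at all s_0 makes the operad axioms pointwise; polynomiality and the joining
    condition then cut out a suboperad. *)
Definition jet_family : modop k := fun_modop (nat * k) (jet_modop P).

Section Components.
Variables (g l : nat) (p : int).

Definition base (y : jet_family g l p) n s : P g l p := (y (n, s)).1.1.
Definition slope (y : jet_family g l p) n s : P g l p := (y (n, s)).1.2.
Definition edge (y : jet_family g l p) n s : P g l (p + 1) := (y (n, s)).2.

Lemma jet_family_ext (y z : jet_family g l p) :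
  base y =2 base z -> slope y =2 slope z -> edge y =2 edge z -> y = z.
Proof.
by move=> e1 e2 e3; apply/funext => -[n s]; apply: triple_ext;
   [exact: e1 | exact: e2 | exact: e3].
Qed.

(* A family of paths c_0, c_1, ... in P tensored with k[s, ds], each of them
   starting at the image under f of the end of the previous one; c_n is
   base y n + edge y n ds, and slope y n is the derivative of base y n. *)
Record is_path (y : jet_family g l p) : Prop := IsPath {
  path_jet : forall n, jet_of (base y n) (slope y n);
  path_edge : forall n, polynomial (edge y n);
  path_joint : forall n, base y n.+1 0 = f g l p (base y n 1)
}.

Lemma is_path0 : is_path 0.
Proof.
split=> [n|n|n]; first exact: jet_of_cst.
  by exists (fun=> 0); exact: jet_of_cst.
by rewrite linear0.
Qed.

Lemma is_path_linear a y z : is_path y -> is_path z -> is_path (a *: y + z).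
Proof.
move=> [y1 y2 y3] [z1 z2 z3]; split=> [n|n|n].
  exact: (jet_ofP a (y1 n) (z1 n)).
  have [y' jy] := y2 n; have [z' jz] := z2 n.
  by eexists; exact: (jet_ofP a jy jz).
transitivity (a *: f g l p (base y n 1) + f g l p (base z n 1)).
  by rewrite -y3 -z3.
exact/esym/linearP.
Qed.

Definition path_space : subspace (jet_family g l p) :=
  Subspace is_path0 is_path_linear.

End Components.

Lemma is_path_diff g l p q (y : jet_family g l p) :
  is_path y -> is_path (diff p q y).
Proof.
move=> [y1 y2 y3]; split=> [n|n|n]; first exact: (jet_of_linear (diff p q) (y1 n)).
  have [y' jy] := y2 n; have [y'' js] := polynomial_deriv (y1 n).
  eexists; exact: (jet_ofP ((-1) ^ p) (jet_of_linear (degree_cast _ p (q + 1)) js)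
    (jet_of_linear (diff (p + 1) (q + 1)) jy)).
by rewrite mhom_diff -y3.
Qed.

Lemma is_path_act g l p (s : 'S_l) (y : jet_family g l p) :
  is_path y -> is_path (act s y).
Proof.
move=> [y1 y2 y3]; split=> [n|n|n]; first exact: (jet_of_linear (act s) (y1 n)).
  have [y' jy] := y2 n; eexists; exact: (jet_of_linear (act s) jy).
by rewrite mhom_act -y3.
Qed.

Lemma is_path_contr g l p (i j : 'I_l.+2) (y : jet_family g l.+2 p) :
  is_path y -> is_path (contr i j y).
Proof.
move=> [y1 y2 y3]; split=> [n|n|n]; first exact: (jet_of_linear (contr i j) (y1 n)).
  have [y' jy] := y2 n; eexists; exact: (jet_of_linear (contr i j) jy).
by rewrite mhom_contr -y3.
Qed.

Lemma is_path_comp g1 l1 p1 g2 l2 p2 g l p (i : 'I_l1.+1)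
    (y : jet_family g1 l1.+1 p1) (z : jet_family g2 l2.+1 p2) :
  is_path y -> is_path z -> is_path (comp g l p i y z).
Proof.
move=> [y1 y2 y3] [z1 z2 z3]; split=> [n|n|n].
- exact: (jet_of_bilinear (comp_linear_l g l p i) (comp_linear_r g l p i)
    (y1 n) (z1 n)).
- have [y' jy] := y2 n; have [z' jz] := z2 n.
  have j1 := jet_of_bilinear (comp_linear_l g l (p + 1) i)
    (comp_linear_r g l (p + 1) i) (y1 n) jz.
  have j2 := jet_of_bilinear (comp_linear_l g l (p + 1) i)
    (comp_linear_r g l (p + 1) i) jy (z1 n).
  eexists; apply: jet_of_ext (jet_ofP ((-1) ^ p2) j2 j1) => [s|s]; last by [].
  exact: addrC.
by rewrite mhom_comp -y3 -z3.
Qed.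

Definition path_modop : modop k :=
  @suboperad k jet_family path_space is_path_diff is_path_act is_path_comp
    is_path_contr.

Definition path_family g l p (y : path_modop g l p) : jet_family g l p :=
  submodule_val (y : submodule (path_space g l p)).

Lemma path_familyP g l p (y : path_modop g l p) : is_path (path_family y).
Proof. exact: (submodule_valP (y : submodule (path_space g l p))). Qed.

Lemma path_ext g l p (y z : path_modop g l p) :
  path_family y = path_family z -> y = z.
Proof. exact: (@val_inj _ _ (submodule (path_space g l p))). Qed.

Definition to_path g l p (y : jet_family g l p) (py : is_path y) :
    path_modop g l p := in_sub (S := path_space g l p) py.

Lemma path_family_linear g l p a (y z : path_modop g l p) :
  path_family (a *: y + z) = a *: path_family y + path_family z.
Proof. exact: (linearP (\val : {linear submodule (path_space g l p) -> _})). Qed.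

Lemma diff_path g l p q (y : path_modop g l p) :
  path_family (diff p q y) = diff p q (path_family y).
Proof. by []. Qed.

Lemma act_path g l p (s : 'S_l) (y : path_modop g l p) :
  path_family (act s y) = act s (path_family y).
Proof. by []. Qed.

Lemma comp_path g1 l1 p1 g2 l2 p2 g l p (i : 'I_l1.+1)
    (y : path_modop g1 l1.+1 p1) (z : path_modop g2 l2.+1 p2) :
  path_family (comp g l p i y z) = comp g l p i (path_family y) (path_family z).
Proof. by []. Qed.

Lemma contr_path g l p (i j : 'I_l.+2) (y : path_modop g l.+2 p) :
  path_family (contr i j y) = contr i j (path_family y).
Proof. by []. Qed.

Definition shift_family g l p (y : jet_family g l p) : jet_family g l p :=
  fun x => y (x.1.+1, x.2).

Lemma is_path_shift g l p y : @is_path g l p y -> is_path (shift_family y).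
Proof.
move=> [y1 y2 y3]; split=> n; first exact: (y1 n.+1).
  exact: (y2 n.+1).
exact: (y3 n.+1).
Qed.

Definition shift_path g l p (y : path_modop g l p) : path_modop g l p :=
  to_path (is_path_shift (path_familyP y)).

Lemma path_family_shift g l p (y : path_modop g l p) :
  path_family (shift_path y) = shift_family (path_family y).
Proof. by []. Qed.

Lemma shift_linear g l p : linear (@shift_path g l p).
Proof.
move=> a y z; apply: path_ext.
by rewrite path_family_linear !path_family_shift path_family_linear.
Qed.

Lemma shift_diff g l p q (y : path_modop g l p) :
  shift_path (diff p q y) = diff p q (shift_path y).
Proof. by apply: path_ext; rewrite diff_path !path_family_shift diff_path. Qed.

Lemma shift_act g l p (s : 'S_l) (y : path_modop g l p) :
  shift_path (act s y) = act s (shift_path y).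
Proof. by apply: path_ext; rewrite act_path !path_family_shift act_path. Qed.

Lemma shift_comp g1 l1 p1 g2 l2 p2 g l p (i : 'I_l1.+1)
    (y : path_modop g1 l1.+1 p1) (z : path_modop g2 l2.+1 p2) :
  shift_path (comp g l p i y z) = comp g l p i (shift_path y) (shift_path z).
Proof. by apply: path_ext; rewrite comp_path !path_family_shift comp_path. Qed.

Lemma shift_contr g l p (i j : 'I_l.+2) (y : path_modop g l.+2 p) :
  shift_path (contr i j y) = contr i j (shift_path y).
Proof. by apply: path_ext; rewrite contr_path !path_family_shift contr_path. Qed.

Definition shift : mhom path_modop path_modop :=
  @Mhom k path_modop path_modop (fun g l p => mk_linear (@shift_linear g l p))
    shift_diff shift_act shift_comp shift_contr.

Definition origin_val g l p (y : path_modop g l p) : P g l p :=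
  base (path_family y) 0 0.

Lemma origin_linear g l p : linear (@origin_val g l p).
Proof. by move=> a y z; rewrite /origin_val path_family_linear. Qed.

Lemma origin_diff g l p q (y : path_modop g l p) :
  origin_val (diff p q y) = diff p q (origin_val y).
Proof. by rewrite /origin_val diff_path. Qed.

Lemma origin_act g l p (s : 'S_l) (y : path_modop g l p) :
  origin_val (act s y) = act s (origin_val y).
Proof. by rewrite /origin_val act_path. Qed.

Lemma origin_comp g1 l1 p1 g2 l2 p2 g l p (i : 'I_l1.+1)
    (y : path_modop g1 l1.+1 p1) (z : path_modop g2 l2.+1 p2) :
  origin_val (comp g l p i y z) = comp g l p i (origin_val y) (origin_val z).
Proof. by rewrite /origin_val comp_path. Qed.

Lemma origin_contr g l p (i j : 'I_l.+2) (y : path_modop g l.+2 p) :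
  origin_val (contr i j y) = contr i j (origin_val y).
Proof. by rewrite /origin_val contr_path. Qed.

Definition origin : mhom path_modop P :=
  @Mhom k path_modop P (fun g l p => mk_linear (@origin_linear g l p))
    origin_diff origin_act origin_comp origin_contr.

End PathOperad.

Section PathModel.
Variables (k : fieldType) (P : modop k) (f : mhom P P).

(** A section of [origin] on which the shift is strictly f; it supplies representatives of all
    homology classes. *)
Definition constant_family g l p (x : P g l p) : jet_family P g l p :=
  fun t => (iter t.1 (f g l p) x, 0, 0).

Lemma is_path_constant g l p (x : P g l p) : is_path f (constant_family x).
Proof.
split=> n; first exact: jet_of_cst.
  by exists (fun=> 0); exact: jet_of_cst.
by [].
Qed.

Definition constant_path g l p (x : P g l p) : path_modop f g l p :=
  to_path (is_path_constant x).

Lemma constant_path_cycle g l p (x : P g l p) :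
  x \in @is_cycle k (P g l) p ->
  constant_path x \in @is_cycle k (path_modop f g l) p.
Proof.
move=> /is_cycleP cx; apply/is_cycleP => q; refine (path_ext _).
apply: jet_family_ext => n s.
- change (diff p q (iter n (f g l p) x) = 0).
  by elim: n => [|n IH]; rewrite ?cx // iterS -mhom_diff IH linear0.
- exact: (linear0 (diff p q)).
change ((-1) ^ p *: degree_cast (P g l) p (q + 1) 0 +
  diff (p + 1) (q + 1) (0 : P g l (p + 1)) = 0).
by rewrite !linear0 addr0.
Qed.

Lemma origin_constant_path g l p (x : P g l p) :
  origin f g l p (constant_path x) = x.
Proof. by []. Qed.

Lemma shift_constant_path g l p (x : P g l p) :
  shift f g l p (constant_path x) = constant_path (f g l p x).
Proof.
refine (path_ext _); apply: jet_family_ext => n s //.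
exact: iterSr.
Qed.

Section WeakEquivalence.
Hypothesis char_k : [pchar k] =i pred0.

(* A closed path whose origin is d u is bounded by the path with components
   u_n +/- int_0^s edge, where u_0 = u and u_(n+1) is the image under f of the
   end of the n-th component. *)
Lemma origin_weak_equivalence : weak_equivalence (origin f).
Proof.
apply: weak_equivalence_intro => g l p.
  move=> x cx; exists (constant_path x); first exact: constant_path_cycle.
  by exists 0; rewrite linear0 origin_constant_path subrr.
move=> y u cy du; have [q e] : exists q, p = q + 1 by exists (p - 1); rewrite subrK.
subst p; move: cy => /is_cycleP /(_ q) /(congr1 (@path_family _ _ _ _ _ _)).
have [y1 y2 y3] := path_familyP y; rewrite diff_path.
set z := path_family y in y1 y2 y3 *.
(* In degree p = q + 1, closedness of the path reads (-1)^p slope + d edge = 0, so slope = e d edge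
   with e = (-1)^(p+1). *)
move=> dz; pose e := (-1) ^ (q + 1 + 1) : k.
have slopeE n s : slope z n s = e *: diff (q + 1 + 1) (q + 1) (edge z n s).
  have dz0 : edge (diff (q + 1) q z) n s = 0 by rewrite dz.
  have : (-1) ^ (q + 1) *: degree_cast (P g l) (q + 1) (q + 1) (slope z n s)
    + diff (q + 1 + 1) (q + 1) (edge z n s) = 0 := dz0.
  rewrite degree_cast_id; set d := diff _ _ _ => /eqP.
  rewrite addr_eq0 => /eqP sE; rewrite -[LHS]scale1r -(sgnK k (q + 1)) -scalerA.
  by rewrite sE scalerN /e (sgnS k (q + 1)) scaleNr.
have /choice [E EP] n := polynomial_primitive char_k (y2 n).
pose us := fix us n := if n is m.+1 then f g l _ (us m + e *: E m 1) else u.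
have dE n : diff (q + 1 + 1) (q + 1) (us n) = base z n 0 -> forall s,
    diff (q + 1 + 1) (q + 1) (us n + e *: E n s) = base z n s.
  move=> dun s; rewrite linearD dun linearZ /=.
  (* This difference has derivative zero by [slopeE], so it equals its value at s = 0, where [E n]
     vanishes. *)
  have : jet_of (fun s => e *: diff (q + 1 + 1) (q + 1) (E n s) - base z n s) (fun=> 0).
    have jE := jet_of_linear (diff (q + 1 + 1) (q + 1)) (EP n).1.
    apply: jet_of_ext (jet_ofP e jE (jet_of_linear -%R (y1 n))) => t //.
    by rewrite /= slopeE subrr.
  move=> /(jet_of_deriv0 char_k) /(_ s); rewrite (EP n).2 !linear0 sub0r.
  by move=> /eqP; rewrite subr_eq => /eqP ->; rewrite addNKr.
have dus n : diff (q + 1 + 1) (q + 1) (us n) = base z n 0.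
  elim: n => [|n IH]; first exact: du.
  by rewrite y3 -(dE _ IH 1) mhom_diff.
pose v : jet_family P g l (q + 1 + 1) :=
  fun t => (us t.1 + e *: E t.1 t.2, e *: edge z t.1 t.2, 0).
have pv : is_path f v.
  split=> n.
  - apply: jet_of_ext (jet_ofP e (EP n).1 (jet_of_cst (us n))) => s.
      exact: addrC.
    exact: addr0.
  - by exists (fun=> 0); exact: jet_of_cst.
  by rewrite /base /= (EP n.+1).2 scaler0 addr0.
exists (to_path pv); refine (path_ext _).
apply: jet_family_ext => n s.
- exact: dE.
- by rewrite [RHS]slopeE; exact: linearZ.
change ((-1) ^ (q + 1 + 1) *:
    degree_cast (P g l) (q + 1 + 1) (q + 1 + 1) (e *: edge z n s) +
  diff (q + 1 + 1 + 1) (q + 1 + 1) (0 : P g l (q + 1 + 1 + 1)) = edge z n s).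
by rewrite degree_cast_id linear0 addr0 scalerA sgnK scale1r.
Qed.

(** On chains [origin] does not intertwine the shift with f: the shifted sequence starts at
    f(c_0(1)), not at f(c_0(0)). It does so on constant families, and these represent every class
    because [origin] is a weak equivalence. *)
Lemma origin_shift g l p h :
  homology_mhom (origin f) g l p (homology_mhom (shift f) g l p h) =
  homology_mhom f g l p (homology_mhom (origin f) g l p h).
Proof.
have [x cx xE] := clsP (homology_mhom (origin f) g l p h).
have cc := constant_path_cycle cx; have cfx := mhom_cycle f cx.
have hE : h = cls (constant_path x).
  apply: (bij_inj (origin_weak_equivalence g l p)); rewrite xE.
  exact/esym/homology_mappE.
have sE : homology_mhom (shift f) g l p h =
    (cls (constant_path (f g l p x)) : homology_modop (path_modop f) g l p).
  by rewrite hE -shift_constant_path; exact: homology_mappE.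
rewrite xE sE; transitivity (cls (f g l p x) : homology_modop P g l p).
  exact: (homology_mappE (origin f) (constant_path_cycle cfx)).
by apply: esym; exact: homology_mappE.
Qed.

End WeakEquivalence.
End PathModel.

(** * Linear recurrences *)

Section Recurrence.
Variables (k : fieldType) (W : lmodType k) (q : {poly k}).
Hypothesis q_neq0 : q != 0.

Definition recurrence (y : nat -> W) (n : nat) : W :=
  \sum_(i < (size q).-1.+1) q`_i *: y (n + i)%N.

Lemma recurrence_solution (init z : nat -> W) :
  exists y, (forall i, (i < (size q).-1)%N -> y i = init i) /\
            (forall n, recurrence y n = z n).
Proof.
pose d := (size q).-1.
(* Stage [Y n] is final at indices below n + d; the next stage sets the entry n + d so that equation
   n holds. The solution is read off the diagonal, at stage j + 1 for the entry j. *)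
pose Y := fix Y n := if n is m.+1 then
    fun j => if j == (m + d)%N
      then (lead_coef q)^-1 *: (z m - \sum_(i < d) q`_i *: Y m (m + i)%N)
      else Y m j
  else init.
have YS n j : (j < n + d)%N -> Y n.+1 j = Y n j.
  by move=> lt; rewrite /= ltn_eqF.
have Ystable n j m : (j < n + d)%N -> Y (m + n)%N j = Y n j.
  move=> lt; elim: m => // m IH.
  by rewrite addSn YS ?IH // (leq_trans lt) // leq_add2r leq_addl.
have YE n j : (j < n + d)%N -> Y j.+1 j = Y n j.
  move=> lt; rewrite -(Ystable _ _ j.+1 lt) addnC; apply/esym/Ystable.
  by rewrite addSn ltnS leq_addr.
exists (fun j => Y j.+1 j); split=> [i lt|n]; first by rewrite (YE 0).
rewrite /recurrence big_ord_recr -/d (YE n.+1) ?addSn ?ltnS // /= eqxx.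
rewrite -/(lead_coef q) scalerA mulfV ?lead_coef_eq0 // scale1r addrC.
rewrite -[RHS](subrK (\sum_(i < d) q`_i *: Y n (n + i)%N)); congr (_ + _).
by apply: eq_bigr => i _; rewrite -(YE n) // ltn_add2l.
Qed.

Lemma recurrence_eq0 (y : nat -> W) :
  (forall i, (i < (size q).-1)%N -> y i = 0) ->
  (forall n, recurrence y n = 0) -> forall n, y n = 0.
Proof.
move=> init rec n; have [m] := ubnP n; elim: m n => // m IH n; rewrite ltnS => le_m.
have [lt|le] := ltnP n (size q).-1; first exact: init.
have := rec (n - (size q).-1)%N; rewrite /recurrence big_ord_recr /=.
rewrite subnK // big1 => [|i _]; last first.
  rewrite IH ?scaler0 // (leq_trans _ le_m) // -[X in (_ < X)%N](subnK le).
  by rewrite ltn_add2l.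
rewrite add0r -/(lead_coef q) => /eqP.
by rewrite scaler_eq0 lead_coef_eq0 (negPf q_neq0) => /eqP.
Qed.

End Recurrence.

Section ShiftSurjective.
Variables (k : fieldType) (P : modop k) (f : mhom P P).
Variables (g l : nat) (p : int).

Local Notation triples := (k -> (P g l p * P g l p * P g l (p + 1)%R)%type).

(** A single path, with no joining condition: in sequences of such paths a recurrence can be solved
    freely, and the joints are checked afterwards. *)
Definition is_jet (w : triples) : Prop :=
  jet_of (fun s => (w s).1.1) (fun s => (w s).1.2) /\
  polynomial (fun s => (w s).2).

Lemma is_jet0 : is_jet 0.
Proof. by split; [|exists (fun=> 0)]; exact: jet_of_cst. Qed.

Lemma is_jet_linear a w v : is_jet w -> is_jet v -> is_jet (a *: w + v).
Proof.
move=> [w1 [w' w2]] [v1 [v' v2]]; split; first exact: (jet_ofP a w1 v1).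
by eexists; exact: (jet_ofP a w2 v2).
Qed.

Definition jet_space : subspace triples := Subspace is_jet0 is_jet_linear.

Definition value (s : k) (w : submodule jet_space) : P g l p := (val w s).1.1.

Lemma value_linear s : linear (value s).
Proof.
move=> a x y; have e : val (a *: x + y) = a *: val x + val y by exact: linearP.
by rewrite /value e.
Qed.
HB.instance Definition _ s :=
  GRing.isLinear.Build k (submodule jet_space) (P g l p) *:%R (value s)
    (value_linear s).

Lemma recurrence_morph (V W : lmodType k) (u : {linear V -> W}) q y n :
  u (recurrence q y n) = recurrence q (u \o y) n.
Proof. by rewrite linear_sum; apply: eq_bigr => i _; rewrite linearZ. Qed.

Lemma recurrenceB (W : lmodType k) q (y z : nat -> W) n :
  recurrence q (fun n => y n - z n) n = recurrence q y n - recurrence q z n.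
Proof. by rewrite -sumrB; apply: eq_bigr => i _; rewrite scalerBr. Qed.

Lemma recurrence_first (W : lmodType k) (q : {poly k}) (y : nat -> W) :
  recurrence q y 0 = q`_0 *: y 0 + \sum_(i < (size q).-1) q`_i.+1 *: y i.+1.
Proof. by rewrite /recurrence big_ord_recl. Qed.

Definition family_of_jets (y : nat -> submodule jet_space) : jet_family P g l p :=
  fun t => val (y t.1) t.2.

Lemma family_of_jets_path y :
  (forall n, value 0 (y n.+1) = f g l p (value 1 (y n))) ->
  is_path f (family_of_jets y).
Proof.
move=> joint; split=> n; last exact: joint.
  exact: (submodule_valP (y n)).1.
exact: (submodule_valP (y n)).2.
Qed.

Definition jets_of_path (y : path_modop f g l p) n : submodule jet_space :=
  in_sub (S := jet_space)
    (conj (path_jet (path_familyP y) n) (path_edge (path_familyP y) n)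
     : jet_space (fun s => path_family y (n, s))).

Lemma poly_act_shift q (y : path_modop f g l p) n : q != 0 ->
  jets_of_path (poly_act (shift f g l p) q y) n =
  recurrence q (jets_of_path y) n.
Proof.
move=> q0.
have jets_lin m : linear (fun y => jets_of_path y m).
  by move=> a u v; apply: val_inj.
pose J m := mk_linear (jets_lin m).
rewrite -[LHS]/(J n _) linear_sum /recurrence prednK ?lt0n ?size_poly_eq0 //.
apply: eq_bigr => i _; rewrite linearZ; congr (_ *: _).
elim: (i : nat) n => [|m IH] n; first by rewrite addn0.
rewrite iterS addnS -addSn -IH; exact: val_inj.
Qed.

(* The recurrence q(shift) y = z is solved with y_0 = c (1 - s) and y_i = 0 for
   0 < i < deg q; the constant c makes y_1, ..., y_(deg q) start at 0. *)
Lemma poly_act_shift_surj (q : {poly k}) (z : path_modop f g l p) :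
  q != 0 -> q`_0 != 0 -> exists y, poly_act (shift f g l p) q y = z.
Proof.
move=> q0 q00; pose c := (q`_0)^-1 *: value 0 (jets_of_path z 0).
pose w s : P g l p * P g l p * P g l (p + 1)%R :=
  ((1 - 'X).[s] *: c, (1 - 'X)^`().[s] *: c, 0).
have jw : jet_space w.
  by split; [exact: jet_of_monomial | exists (fun=> 0); exact: jet_of_cst].
pose init n : submodule jet_space := if n is 0%N then in_sub jw else 0.
have [y [y_init y_rec]] := recurrence_solution q0 init (jets_of_path z).
have start i : (i < (size q).-1)%N -> value 0 (y i.+1) = 0.
  move=> lt; have [lt'|] := ltnP i.+1 (size q).-1; first by rewrite y_init.
  move=> ge; have e : (size q).-1 = i.+1 by apply/eqP; rewrite eqn_leq ge lt.
  (* At s = 0 the first equation reduces to q_0 c + lead(q) y_(deg q)(0) = z_0(0). The choice c =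
     z_0(0) / q_0, possible as q(0) is nonzero, forces y_(deg q)(0) = 0. *)
  have := congr1 (value 0) (y_rec 0%N); rewrite recurrence_morph recurrence_first.
  rewrite e big_ord_recr /= big1 ?add0r => [|j _]; last first.
    by rewrite y_init ?linear0 ?scaler0 // e ltnS.
  rewrite y_init ?e // /init /value /= hornerD hornerN hornerC hornerX subr0 scale1r.
  rewrite scalerA mulfV // scale1r -[X in _ = X -> _]addr0 => /addrI /eqP.
  have -> : q`_i.+1 = lead_coef q by rewrite /lead_coef e.
  by rewrite scaler_eq0 lead_coef_eq0 (negPf q0) => /eqP.
have stop i : (i < (size q).-1)%N -> value 1 (y i) = 0.
  move=> lt; rewrite y_init //; case: i lt => [|i] lt //=.
  by rewrite /value /= hornerD hornerN hornerC hornerX subrr scale0r.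
(* The defects of the joints satisfy the homogeneous recurrence, since z has none, and they vanish
   for n below deg q by [start] and [stop]; so they all vanish. *)
have joint n : value 0 (y n.+1) = f g l p (value 1 (y n)).
  apply/eqP; rewrite -subr_eq0; apply/eqP; move: n.
  apply: (recurrence_eq0 q0) => [i lt|n]; first by rewrite start ?stop // linear0 subrr.
  rewrite recurrenceB.
  transitivity (value 0 (jets_of_path z n.+1) - f g l p (value 1 (jets_of_path z n))).
    congr (_ - _).
      by rewrite -y_rec recurrence_morph; apply: eq_bigr => i _; rewrite addSn.
    by rewrite -y_rec !recurrence_morph.
  by apply/eqP; rewrite subr_eq0; apply/eqP; exact: path_joint (path_familyP z) n.
exists (to_path (family_of_jets_path joint)); apply: path_ext.
apply/funext => -[n s].
have := poly_act_shift (to_path (family_of_jets_path joint)) n q0.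
move=> /(congr1 (fun w => val w s)) /= ->; rewrite -[RHS]/(val (jets_of_path z n) s) -y_rec; congr (val _ s).
by apply: eq_bigr => i _; congr (_ *: _); exact: val_inj.
Qed.

End ShiftSurjective.

(** * Weights *)

Lemma cls_poly_act (k : fieldType) (Q : modop k) (s : mhom Q Q) g l p
    (q : {poly k}) (x : Q g l p) : x \in @is_cycle k (Q g l) p ->
  poly_act (s g l p) q x \in @is_cycle k (Q g l) p /\
  cls (poly_act (s g l p) q x) =
    poly_act (homology_mhom s g l p) q (cls x : homology_modop Q g l p).
Proof.
elim/poly_ind: q x => [|q c IH] x cx.
  by rewrite -[0]/(0%:P) !poly_actC !scale0r cls0 rpred0.
have [cq qE] := IH _ (mhom_cycle s cx).
rewrite !poly_actD !poly_actMX !poly_actC; split; first by rewrite rpredD ?rpredZ.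
have -> : poly_act (homology_mhom s g l p) q (homology_mhom s g l p (cls x)) =
    cls (poly_act (s g l p) q (s g l p x)).
  by rewrite qE; congr (poly_act _ _ _); exact: homology_mappE.
by rewrite clsD ?rpredZ // clsZ.
Qed.

Section WeightTruncation.
Variables (k : fieldType) (K : closedFieldType) (iota : {rmorphism k -> K}).
Variables (w : weight_function K) (Q : modop k) (s : mhom Q Q).

Definition weight_le (m : int) (a : K) : Prop := weight_dom w a /\ weight w a <= m.
Definition weight_eq (m : int) (a : K) : Prop := weight_dom w a /\ weight w a = m.

Lemma weight_leM m n a b :
  weight_le m a -> weight_le n b -> weight_le (m + n) (a * b).
Proof.
move=> [da wa] [db wb]; split; first exact: weight_domM.
by rewrite weightM // lerD.
Qed.

Lemma weight_le_sub m n a : m <= n -> weight_le m a -> weight_le n a.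
Proof. by move=> le [da wa]; split=> //; exact: le_trans le. Qed.

Lemma weight_le_neq0 m a : weight_le m a -> a != 0.
Proof. by case=> /weight_dom_neq0. Qed.

Lemma weight_eq_le m a : weight_eq m a -> weight_le m a.
Proof. by move=> [da e]; split=> //; rewrite e. Qed.

Lemma weight_le_eq m n a : m < n -> weight_le m a -> ~ weight_eq n a.
Proof. by move=> lt [_ wa] [_ e]; move: lt; rewrite -e ltNge wa. Qed.

(** Weights are defined on units only, so 0 is never a root; this gives access to the surjectivity
    of q(f). *)
Lemma roots_in_coef0 m q : roots_in iota (weight_le m) q -> q`_0 != 0.
Proof.
move=> [_ qm]; apply/negP => /eqP q00.
have /weight_le_neq0 : weight_le m 0.
  by apply: qm; rewrite rootE horner_coef0 coef_map /= q00 raddf0.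
by rewrite eqxx.
Qed.

Definition weight_filtration g l p (m : int) (x : Q g l p) : Prop :=
  torsion iota (weight_le m) (s g l p) x.

Lemma weight_filtration_sub g l p m n (x : Q g l p) : m <= n ->
  weight_filtration m x -> weight_filtration n x.
Proof. by move=> le; apply: torsion_sub => a; exact: weight_le_sub. Qed.

Lemma weight_filtration_diff g l p q m (x : Q g l p) :
  weight_filtration m x -> weight_filtration m (diff p q x).
Proof. by apply: torsion_morph => y; rewrite mhom_diff. Qed.

Lemma weight_filtration_act g l p m (t : 'S_l) (x : Q g l p) :
  weight_filtration m x -> weight_filtration m (act t x).
Proof. by apply: torsion_morph => y; rewrite mhom_act. Qed.

Lemma weight_filtration_contr g l p m (i j : 'I_l.+2) (x : Q g l.+2 p) :
  weight_filtration m x -> weight_filtration m (contr i j x).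
Proof. by apply: torsion_morph => y; rewrite mhom_contr. Qed.

Lemma weight_filtration_comp g1 l1 p1 g2 l2 p2 g l p (i : 'I_l1.+1) m n
    (x : Q g1 l1.+1 p1) (y : Q g2 l2.+1 p2) :
  weight_filtration m x -> weight_filtration n y ->
  weight_filtration (m + n) (comp g l p i x y).
Proof.
apply: (torsion_bilinear (f1 := s g1 l1.+1 p1) (f2 := s g2 l2.+1 p2)
         (B := comp g l p i)).
- exact: comp_linear_l.
- exact: comp_linear_r.
- by move=> u v; rewrite mhom_comp.
- by move=> b; exact: weight_le_neq0.
by move=> a b; exact: weight_leM.
Qed.

(* x lies in the truncation of the weight decomposition to weights at most p,
   its part of weight p being closed with class h. *)
Definition truncates g l p (x : Q g l p) (h : homology_modop Q g l p) : Prop :=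
  exists y z, [/\ x = y + z, weight_filtration (p - 1) y, weight_filtration p z,
    z \in @is_cycle k (Q g l) p & h = cls z].

Lemma truncates_linear g l p a (x x' : Q g l p) h h' :
  truncates x h -> truncates x' h' -> truncates (a *: x + x') (a *: h + h').
Proof.
move=> [y [z [-> Fy Fz cz ->]]] [y' [z' [-> Fy' Fz' cz' ->]]].
exists (a *: y + y'), (a *: z + z'); split.
- by rewrite scalerDr addrACA.
- exact: torsion_linear.
- exact: torsion_linear.
- by rewrite rpredD ?rpredZ.
by rewrite cls_linear.
Qed.

Lemma truncates_cycle g l p (x : Q g l p) : weight_filtration p x ->
  x \in @is_cycle k (Q g l) p -> truncates x (cls x).
Proof. by move=> Fx cx; exists 0, x; split=> //; [rewrite add0r | exact: torsion0]. Qed.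

Lemma truncates0 g l p : truncates (0 : Q g l p) 0.
Proof.
rewrite -[X in truncates _ X](@cls0 k (Q g l) p).
by apply: truncates_cycle; [exact: torsion0 | rewrite rpred0].
Qed.

(** The differential keeps the weight and lowers the degree by one, so d y, of weight at most p - 1,
    is an admissible closed part in degree p - 1. Being a boundary, it has class 0, as a map to a
    complex with zero differential requires. *)
Lemma truncates_diff g l p q (x : Q g l p) h :
  truncates x h -> truncates (diff p q x) 0.
Proof.
move=> [y [z [-> Fy Fz /is_cycleP cz _]]]; rewrite linearD cz addr0.
have [e|ne] := eqVneq p (q + 1); last by rewrite diff_dead //; exact: truncates0.
subst p; rewrite addrK in Fy.
have cdy : diff (q + 1) q y \in @is_cycle k (Q g l) q.
  by apply/is_cycleP => r; exact: diffK.
have -> : (0 : homology_modop Q g l q) = cls (diff (q + 1) q y).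
  by apply/esym/cls_eq0 => //; exists y.
exact: truncates_cycle (weight_filtration_diff q Fy) cdy.
Qed.

Lemma truncates_act g l p (t : 'S_l) (x : Q g l p) h :
  truncates x h -> truncates (act t x) (act t h).
Proof.
move=> [y [z [-> Fy Fz cz ->]]]; exists (act t y), (act t z); split.
- exact: linearD.
- exact: weight_filtration_act.
- exact: weight_filtration_act.
- exact: act_cycle.
exact: act_cls.
Qed.

Lemma truncates_contr g l p (i j : 'I_l.+2) (x : Q g l.+2 p) h :
  truncates x h -> truncates (contr i j x) (contr i j h).
Proof.
move=> [y [z [-> Fy Fz cz ->]]]; exists (contr i j y), (contr i j z); split.
- exact: linearD.
- exact: weight_filtration_contr.
- exact: weight_filtration_contr.
- exact: contr_cycle.
exact: contr_cls.
Qed.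

(** Every term other than the composition of the closed parts has a factor of weight below its
    degree, and so has total weight at most p - 1. *)
Lemma truncates_comp g1 l1 p1 g2 l2 p2 g l p (i : 'I_l1.+1)
    (x : Q g1 l1.+1 p1) (x' : Q g2 l2.+1 p2) h h' :
  truncates x h -> truncates x' h' ->
  truncates (comp g l p i x x') (comp g l p i h h').
Proof.
move=> [y [z [-> Fy Fz cz ->]]] [y' [z' [-> Fy' Fz' cz' ->]]].
case gl : (glues g1 l1 p1 g2 l2 p2 g l p); last first.
  by rewrite !comp_dead ?gl //; exact: truncates0.
have /and3P [_ _ /eqP pE] := gl.
have Fle m n (a : Q g1 l1.+1 p1) (b : Q g2 l2.+1 p2) r : m + n <= r ->
    weight_filtration m a -> weight_filtration n b ->
    weight_filtration r (comp g l p i a b).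
  move=> le Fa Fb; apply: weight_filtration_sub le _.
  exact: weight_filtration_comp.
exists (comp g l p i y (y' + z') + comp g l p i z y'), (comp g l p i z z'); split.
- by rewrite compDl (compDr _ _ _ _ z) addrA.
- have le : p1 - 1 + p2 <= p - 1 by rewrite pE addrAC.
  have le' : p1 + (p2 - 1) <= p - 1 by rewrite pE addrA.
  apply: torsionD; last exact: Fle le' Fz Fy'.
  apply: Fle le Fy _; apply: torsionD => //.
  by apply: weight_filtration_sub Fy'; rewrite lerBlDr lerDl.
- by apply: Fle Fz Fz'; rewrite pE.
- exact: comp_cycle.
exact: comp_cls.
Qed.

Definition in_truncation g l p (x : Q g l p) : Prop := exists h, truncates x h.

Lemma in_truncation0 g l p : @in_truncation g l p 0.
Proof. by exists 0; exact: truncates0. Qed.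

Lemma in_truncation_linear g l p a (x y : Q g l p) :
  in_truncation x -> in_truncation y -> in_truncation (a *: x + y).
Proof. by move=> [h xh] [h' yh']; eexists; exact: truncates_linear xh yh'. Qed.

Definition truncation_space g l p : subspace (Q g l p) :=
  Subspace (@in_truncation0 g l p) (@in_truncation_linear g l p).

Lemma in_truncation_diff g l p q x :
  truncation_space g l p x -> truncation_space g l q (diff p q x).
Proof. by move=> [h xh]; eexists; exact: truncates_diff xh. Qed.

Lemma in_truncation_act g l p (t : 'S_l) x :
  truncation_space g l p x -> truncation_space g l p (act t x).
Proof. by move=> [h xh]; eexists; exact: truncates_act xh. Qed.

Lemma in_truncation_comp g1 l1 p1 g2 l2 p2 g l p (i : 'I_l1.+1) x y :
  truncation_space g1 l1.+1 p1 x -> truncation_space g2 l2.+1 p2 y ->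
  truncation_space g l p (comp g l p i x y).
Proof. by move=> [h xh] [h' yh']; eexists; exact: truncates_comp xh yh'. Qed.

Lemma in_truncation_contr g l p (i j : 'I_l.+2) x :
  truncation_space g l.+2 p x -> truncation_space g.+1 l p (contr i j x).
Proof. by move=> [h xh]; eexists; exact: truncates_contr xh. Qed.

Definition truncation : modop k :=
  suboperad in_truncation_diff in_truncation_act in_truncation_comp
    in_truncation_contr.

Definition inclusion : mhom truncation Q := suboperad_val _ _ _ _.

Definition to_truncation g l p x (Tx : in_truncation x) : truncation g l p :=
  in_sub (S := truncation_space g l p) Tx.

Lemma inclusion_to_truncation g l p x (Tx : @in_truncation g l p x) :
  inclusion g l p (to_truncation Tx) = x.
Proof. by []. Qed.

Lemma inclusionP g l p (x : truncation g l p) : in_truncation (inclusion g l p x).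
Proof. exact: (submodule_valP (x : submodule (truncation_space g l p))). Qed.

Lemma inclusion_inj g l p (x y : truncation g l p) :
  inclusion g l p x = inclusion g l p y -> x = y.
Proof. exact: (@val_inj _ _ (submodule (truncation_space g l p))). Qed.

Lemma inclusion_cycle g l p (x : truncation g l p) :
  inclusion g l p x \in @is_cycle k (Q g l) p ->
  x \in @is_cycle k (truncation g l) p.
Proof.
move=> /is_cycleP cx; apply/is_cycleP => q; apply: inclusion_inj.
by rewrite mhom_diff cx linear0.
Qed.

Section Formality.
Hypothesis homology_pure : forall g l p, exists2 chi,
  roots_in iota (weight_eq p) chi &
  forall h, poly_act (homology_mhom s g l p) chi h = 0.
Hypothesis act_surj : forall g l p (q : {poly k}) z, q != 0 -> q`_0 != 0 ->
  exists y, poly_act (s g l p) q y = z.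

(** The class is killed by a polynomial with roots of weight below p and by one with roots of weight
    p, and these are coprime. *)
Lemma cls_low_weight g l p (x : Q g l p) : x \in @is_cycle k (Q g l) p ->
  weight_filtration (p - 1) x -> cls x = 0.
Proof.
move=> cx [q qr qx]; have [chi chir chi0] := homology_pure g l p.
apply: (@torsion_disjoint k K iota (weight_le (p - 1)) _ (homology_mhom s g l p)
  (weight_eq p)).
- by move=> a; apply: weight_le_eq; rewrite ltrBlDr ltrDl.
- by exists q => //; rewrite -(cls_poly_act s q cx).2 qx cls0.
by exists chi.
Qed.

(** If chi kills the class of x, then chi(s) x = d u. Solving chi(s) v = u gives a homologous cycle
    x - d v that chi(s) kills on the nose. *)
Lemma weight_lift g l p (h : homology_modop Q g l p) :
  exists x, [/\ x \in @is_cycle k (Q g l) p, weight_filtration p x & h = cls x].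
Proof.
have [chi chir chi0] := homology_pure g l p; have [x cx ->] := clsP h.
have chir' := roots_in_sub (@weight_eq_le p) chir.
have [cy yE] := cls_poly_act s chi cx.
have [u du] : exists u, diff (p + 1) p u = poly_act (s g l p) chi x.
  by apply/cls_eq0 => //; rewrite yE chi0.
have [v vu] := act_surj u chir.1 (roots_in_coef0 chir').
have cdv : diff (p + 1) p v \in @is_cycle k (Q g l) p.
  by apply/is_cycleP => q; exact: diffK.
exists (x - diff (p + 1) p v); split.
- by rewrite rpredB.
- exists chi => //; rewrite linearB /= -du -vu.
  rewrite (poly_act_morph (f := s g l (p + 1)) (f' := s g l p)) ?subrr //.
  by move=> y; rewrite mhom_diff.
by apply/cls_eq; rewrite ?rpredB //; exists v; rewrite subKr.
Qed.

(** Two decompositions of x differ by 0 = y + z; then the cycle z = - y has weight at most p - 1,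
    and its class vanishes. *)
Lemma truncates_functional g l p (x : Q g l p) h h' :
  truncates x h -> truncates x h' -> h = h'.
Proof.
move=> xh xh'; apply/eqP; rewrite -subr_eq0; apply/eqP.
have := truncates_linear (-1) xh' xh; rewrite !scaleN1r addNr addrC.
move=> [y [z [e Fy Fz cz ->]]]; apply: cls_low_weight => //.
have -> : z = - y by apply/eqP; rewrite -addr_eq0 addrC -e.
by rewrite -scaleN1r; exact: torsionZ.
Qed.

(* A bound u of x can be corrected by a boundary so that (chi * q)(s) kills it,
   where q(s) x = 0; Bezout then splits u into a closed part of weight at most
   p + 1 and a part of weight at most p. *)
Lemma truncation_boundary g l p (x : truncation g l p) u :
  diff (p + 1) p u = inclusion g l p x -> exists v, diff (p + 1) p v = x.
Proof.
move=> du; have [q qr qx] : weight_filtration p (inclusion g l p x).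
  have [_ [y [z [-> Fy Fz _ _]]]] := inclusionP x; apply: torsionD => //.
  by apply: weight_filtration_sub Fy; rewrite lerBlDr lerDl.
have [chi chir chi0] := homology_pure g l (p + 1).
have diff_morph r y : diff (p + 1) p (poly_act (s g l (p + 1)) r y) =
    poly_act (s g l p) r (diff (p + 1) p y).
  by apply: poly_act_morph => z; rewrite mhom_diff.
have cqu : poly_act (s g l (p + 1)) q u \in @is_cycle k (Q g l) (p + 1).
  apply/is_cycleP => r; have [->|ne] := eqVneq r p.
    by rewrite diff_morph du.
  by rewrite diff_dead // (inj_eq (addIr _)) eq_sym.
have [ccqu eE] := cls_poly_act s chi cqu.
have [t dt] : exists t, diff (p + 1 + 1) (p + 1) t =
    poly_act (s g l (p + 1)) (chi * q) u.
  by rewrite poly_actM; apply/cls_eq0 => //; rewrite eE chi0.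
have chir' := roots_in_sub (@weight_eq_le (p + 1)) chir.
have qr' : roots_in iota (weight_le (p + 1)) q.
  by apply: roots_in_sub qr => a; apply: weight_le_sub; rewrite lerDl.
have chiqr := roots_inM chir' qr'.
have [v tE] := act_surj t chiqr.1 (roots_in_coef0 chiqr).
pose u' := u - diff (p + 1 + 1) (p + 1) v.
have du' : diff (p + 1) p u' = inclusion g l p x by rewrite linearB diffK subr0.
have u'0 : poly_act (s g l (p + 1)) (chi * q) u' = 0.
  rewrite linearB /= -dt -tE (poly_act_morph (f := s g l (p + 1 + 1))
    (f' := s g l (p + 1))) ?subrr // => y.
  by rewrite mhom_diff.
have [|A [B AB]] := roots_in_Bezout qr chir.
  by move=> a; apply: weight_le_eq; rewrite ltrDl.
suff Tu' : in_truncation u'.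
  exists (to_truncation Tu'); apply: inclusion_inj.
  by rewrite mhom_diff inclusion_to_truncation du'.
eexists; exists (poly_act (s g l (p + 1)) (B * chi) u'),
  (poly_act (s g l (p + 1)) (A * q) u'); split; last by [].
- by rewrite -poly_actD [B * chi + _]addrC AB poly_act1.
- rewrite addrK; exists q => //.
  by rewrite -poly_actM mulrCA poly_actM [q * chi]mulrC u'0 linear0.
- exists chi => //.
  by rewrite -poly_actM mulrCA poly_actM u'0 linear0.
apply/is_cycleP => r; have [->|ne] := eqVneq r p.
  by rewrite diff_morph du' poly_actM qx linear0.
by rewrite diff_dead // (inj_eq (addIr _)) eq_sym.
Qed.

Lemma inclusion_weak_equivalence : weak_equivalence inclusion.
Proof.
apply: weak_equivalence_intro => g l p; last first.
  by move=> x u _; exact: truncation_boundary.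
move=> y cy; have [x [cx Fx e]] := weight_lift (cls y).
have Tx : in_truncation x by eexists; exact: truncates_cycle.
exists (to_truncation Tx); first exact: inclusion_cycle.
by apply/cls_eq => //; rewrite inclusion_to_truncation.
Qed.

Definition top_class g l p (x : truncation g l p) : homology_modop Q g l p :=
  projT1 (cid (inclusionP x)).

Lemma top_classE g l p (x : truncation g l p) h :
  truncates (inclusion g l p x) h -> top_class x = h.
Proof. by apply: truncates_functional; exact: projT2 (cid (inclusionP x)). Qed.

Lemma top_classP g l p (x : truncation g l p) :
  truncates (inclusion g l p x) (top_class x).
Proof. exact: projT2 (cid (inclusionP x)). Qed.

Lemma top_class_linear g l p : linear (@top_class g l p).
Proof.
move=> a x y; apply: top_classE; rewrite linearP.
by apply: truncates_linear; exact: top_classP.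
Qed.

Definition top_class_mhom : mhom truncation (homology_modop Q).
Proof.
refine (@Mhom k truncation (homology_modop Q)
  (fun g l p => mk_linear (@top_class_linear g l p)) _ _ _ _).
- move=> g l p q x; apply: top_classE; rewrite mhom_diff.
  exact: truncates_diff (top_classP x).
- move=> g l p t x; apply: top_classE; rewrite mhom_act.
  exact: truncates_act (top_classP x).
- move=> g1 l1 p1 g2 l2 p2 g l p i x y; apply: top_classE; rewrite mhom_comp.
  exact: truncates_comp (top_classP x) (top_classP y).
- move=> g l p i j x; apply: top_classE; rewrite mhom_contr.
  exact: truncates_contr (top_classP x).
Defined.

Lemma top_class_weak_equivalence : weak_equivalence top_class_mhom.
Proof.
apply: weak_equivalence_intro => g l p.
  move=> h _; have [x [cx Fx ->]] := weight_lift h.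
  have Tx : in_truncation x by eexists; exact: truncates_cycle.
  exists (to_truncation Tx); first exact: inclusion_cycle.
  exists 0; rewrite linear0; apply/esym/eqP; rewrite subr_eq0; apply/eqP.
  by apply: top_classE; exact: truncates_cycle.
move=> x u cx du; have x0 : top_class x = 0 by exact: esym du.
(* Here z has class 0, and y = x - z is a cycle of low weight, so x bounds in Q;
   [truncation_boundary] moves the bound into the truncation. *)
have := top_classP x; rewrite x0 => -[y [z [xE Fy _ cz zE]]].
have [|v dv] := (cls_eq0 (mhom_cycle inclusion cx)).1; last first.
  exact: truncation_boundary dv.
have cy : y \in @is_cycle k (Q g l) p.
  by rewrite -[y](addrK z) -xE rpredB // mhom_cycle.
by rewrite xE -[y]scale1r cls_linear // -zE addr0 cls_low_weight // scaler0.
Qed.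

Lemma pure_formal : formal Q.
Proof.
constructor; apply: (@zigzag_forward _ _ truncation _ top_class_mhom).
  exact: zigzag_backward (zigzag_refl Q) inclusion_weak_equivalence.
exact: top_class_weak_equivalence.
Qed.

End Formality.
End WeightTruncation.

Lemma pure_endomorphism_formal (k : fieldType) (char_k : [pchar k] =i pred0)
    (K : closedFieldType) (iota : {rmorphism k -> K}) (w : weight_function K)
    (P : modop k) (f : mhom P P) :
  pure iota w f -> formal P.
Proof.
move=> f_pure; apply: (@formal_weakly_equivalent _ _ (path_modop f)).
  constructor; apply: zigzag_backward (zigzag_refl P) _.
  exact: origin_weak_equivalence.
apply: (@pure_formal k K iota w _ (shift f)) => [g l p|g l p q z q0 q00]; last first.
  exact: poly_act_shift_surj.
have [chi chiE chir] := f_pure g l p; exists chi.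
  by split=> //; have [n [e [M [_ _ ->]]]] := chiE; exact/monic_neq0/char_poly_monic.
move=> h; apply: (bij_inj (origin_weak_equivalence f char_k g l p)).
rewrite (poly_act_morph (f' := homology_mhom f g l p)) ?linear0; last first.
  exact: origin_shift.
exact: char_poly_kills chiE.
Qed.

(** * Grading automorphisms as pure endomorphisms, and the equivalence *)

Lemma grading_aut (k : fieldType) (P : modop k) (alpha : k) (alpha0 : alpha != 0) :
  is_aut (grading_mhom P alpha0).
Proof.
have alphaV0 : alpha^-1 != 0 by rewrite invr_eq0.
exists (grading_mhom P alphaV0) => g l p; split=> x /=; rewrite /grading_mapp.
  by rewrite scalerA -expfzMl mulVf // exp1rz scale1r.
by rewrite scalerA -expfzMl mulfV // exp1rz scale1r.
Qed.

Section PowerWeight.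
Variables (K : fieldType) (a : K).
Hypothesis a_neq0 : a != 0.
Hypothesis a_free : forall n : nat, (0 < n)%N -> a ^+ n != 1.

Lemma exprz_eq1 (m : int) : a ^ m = 1 -> m = 0.
Proof.
case: m => [[|n]|n] // e; have := a_free (ltn0Sn n).
  by rewrite (_ : a ^+ n.+1 = 1) ?eqxx.
rewrite (_ : a ^+ n.+1 = 1) ?eqxx //; apply: invr_inj; rewrite invr1; exact: e.
Qed.

Lemma exprz_inj : injective (exprz a).
Proof.
move=> m n e; apply/eqP; rewrite -subr_eq0; apply/eqP/exprz_eq1.
by rewrite expfzDr // e -expfzDr // subrr.
Qed.

(** The weight a^m -> m on the cyclic group generated by a, well defined because a is not a root of
    unity; 0 is a default value outside that group. *)
Definition power_weight (x : K) : int :=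
  if pselect (exists m : int, x = a ^ m) is left e then projT1 (cid e) else 0.

Lemma power_weightE m : power_weight (a ^ m) = m.
Proof.
rewrite /power_weight; case: pselect => [e|[]]; last by exists m.
by apply: exprz_inj; rewrite -(projT2 (cid e)).
Qed.

Definition power_weight_function : weight_function K.
Proof.
refine (@WeightFunction K (fun x => exists m : int, x = a ^ m) power_weight _ _ _ _ _).
- by move=> _ [m ->]; rewrite expfz_neq0.
- by exists 0; rewrite expr0z.
- by move=> _ _ [m ->] [n ->]; exists (m + n); rewrite expfzDr.
- by move=> _ [m ->]; exists (- m); rewrite -invr_expz.
- by move=> _ _ [m ->] [n ->]; rewrite -expfzDr // !power_weightE.
Defined.

End PowerWeight.

(** Transported to HP', the action on H_p is the scalar alpha^p, whose only possible eigenvalue has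
    weight p for the weight function of the powers of alpha. *)
Lemma grading_lift_pure (k : fieldType) (K : fieldType) (iota : {rmorphism k -> K})
    (P P' : modop k) (z : zigzag P' P) (f : mhom P' P') (alpha : k)
    (alpha0 : alpha != 0) :
  finite_type_homology P -> (forall n : nat, (0 < n)%N -> alpha ^+ n != 1) ->
  induces z f (grading_mhom P alpha0) ->
  exists w : weight_function K, pure iota w f.
Proof.
move=> finP alpha_free f_alpha.
have a0 : iota alpha != 0 by rewrite fmorph_eq0.
have a_free n : (0 < n)%N -> iota alpha ^+ n != 1.
  by move=> n0; rewrite -rmorphXn -(rmorph1 iota) (inj_eq (fmorph_inj iota)) alpha_free.
exists (power_weight_function a0 a_free) => g l p.
have [Z [ZE Zbij]] := zigzag_homology_mhom z.
have [V VK] := mhom_inv Zbij.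
have [[/(_ p) [n [e e_bij]] _] _] := (finP g l, tt).
exists (char_poly ((alpha ^ p)%:M : 'M_n)).
  exists n, (V g l p \o e), (alpha ^ p)%:M; split=> // [|v].
    apply: bij_comp e_bij; exists (Z g l p); first exact: (VK g l p).2.
    exact: (VK g l p).1.
  apply: (bij_inj (Zbij g l p)); rewrite ZE f_alpha -ZE.
  by rewrite /= !(VK g l p).2 mul_mx_scalar linearZ.
move=> x; rewrite char_poly_trig ?scalar_mx_is_trig // rmorph_prod rootE horner_prod.
rewrite prodf_seq_eq0 => /hasP [i _ /=].
rewrite rmorphB /= map_polyX map_polyC hornerXsubC subr_eq0.
rewrite mxE eqxx mulr1n => /eqP ->.
have e_p : power_weight (iota alpha) (iota alpha ^ p) = p by exact: power_weightE.
split; first by exists p; exact: fmorphXz.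
by rewrite -[RHS]e_p; congr power_weight; exact: fmorphXz.
Qed.

Theorem theorem8p8p2 (k : fieldType) (char_k : [pchar k] =i pred0)
    (kbar : closedFieldType) (iota : {rmorphism k -> kbar})
    (kbar_algebraic : forall x : kbar, algebraicOver iota x)
    (P : modop k) (finP : finite_type_homology P) :
  [<-> formal P;
       exists (P' : modop k) (z : zigzag P' P),
         forall psi : mhom (homology_modop P) (homology_modop P),
           is_aut psi -> exists2 f : mhom P' P', is_aut f & induces z f psi;
       exists (P' : modop k) (z : zigzag P' P) (f : mhom P' P')
              (alpha : k) (alpha_neq0 : alpha != 0),
         [/\ is_aut f,
             forall n : nat, (0 < n)%N -> alpha ^+ n != 1
           & induces z f (grading_mhom P alpha_neq0)];
       exists (P' : modop k) (z : zigzag P' P) (f : mhom P' P')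
              (w : weight_function kbar), pure iota w f].
Proof.
tfae.
- exact: formal_automorphisms_lift.
(* The choice alpha = 2 works in characteristic zero: for n > 0, 2^n - 1 is a positive integer and
   so nonzero in k. *)
- have two0 : 2%:R != 0 :> k by exact: natr_neq0.
  move=> [P' [z lift]]; have [f f_aut f2] := lift _ (grading_aut P two0).
  exists P', z, f, 2%:R, two0; split=> // n n_gt0.
  rewrite -natrX -subr_eq0 -[1]/(1%:R) -natrB ?expn_gt0 //.
  have := ltn_expl n (ltnSn 1); case: (2 ^ n)%N => [|[|m]] //.
    by case: n n_gt0 {f2}.
  by move=> _; rewrite subn1; exact: natr_neq0.
- move=> [P' [z [f [alpha [alpha0 [_ alpha_free f_alpha]]]]]].
  have [w f_pure] := grading_lift_pure iota finP alpha_free f_alpha.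
  by exists P', z, f, w.
move=> [P' [z [f [w f_pure]]]].
apply: formal_weakly_equivalent (pure_endomorphism_formal char_k f_pure).
by constructor; exact: zigzag_sym.
Qed.
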